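(* Let $\Omega\subset\mathbb R^n$ be open, $t_1<t_2$, and let $f$ be continuous on $\Omega\times(t_1,t_2)$. Let $\psi:(0,\infty)\to(0,\infty)$ satisfy $\lim_{\varepsilon\to0}\psi(\varepsilon)=\infty$ and $\lim_{\varepsilon\to0}\varepsilon\,\psi(\varepsilon)=0$. A function $u\in C(\Omega\times(t_1,t_2))$ that is convex in the spatial variable is a viscosity solution of $$\frac{\partial u}{\partial t}(x,t)=\big(\det D^2u(x,t)\big)^{1/n}+f(x,t)\quad\text{in }\Omega\times(t_1,t_2)$$ if and only if $$u(x,t)=\inf_{\substack{\det A=1\\ A\le \psi(\varepsilon)I}}\left\{\frac{1}{\frac{n}{n+2}\varepsilon^2}\int_{t-\frac{n}{n+2}\varepsilon^2}^{t}\frac{1}{|B_\varepsilon(0)|}\int_{B_\varepsilon(0)}u(x+Ay,s)\,dy\,ds\right\}+\frac{n}{2(n+2)}f(x,t)\,\varepsilon^2+o(\varepsilon^2)\quad\text{as }\varepsilon\to0,$$ for $x\in\Omega$, $t\in(t_1,t_2)$, in the viscosity sense.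
   Context: The infimum is over symmetric positive definite $n\times n$ matrices $A$; $A\le\theta I$ means $\theta I-A$ is positive semidefinite. $C^{2,1}$ denotes functions twice continuously differentiable in $x$ and continuously differentiable in $t$. For a constant $c$ and function $g$, ''$c\le g(\varepsilon)+o(\varepsilon^2)$'' means $\lim_{\varepsilon\to0}[c-g(\varepsilon)]^+/\varepsilon^2=0$ and ''$c\ge g(\varepsilon)+o(\varepsilon^2)$'' means $\lim_{\varepsilon\to0}[c-g(\varepsilon)]^-/\varepsilon^2=0$. Viscosity solution: a continuous $u$, convex in $x$, is a viscosity solution of $\partial_t u=(\det D^2u)^{1/n}+f$ if for every $(x,t)\in\Omega\times(t_1,t_2)$ and every $\phi\in C^{2,1}$ convex in the spatial variable: (i) if $u-\phi$ has a strict local maximum at $(x,t)$ with $u(x,t)=\phi(x,t)$, then $\partial_t\phi(x,t)-(\det D^2\phi(x,t))^{1/n}\le f(x,t)$; (ii) if $u-\phi$ has a strict local minimum at $(x,t)$ with $u(x,t)=\phi(x,t)$, then $\partial_t\phi(x,t)-(\det D^2\phi(x,t))^{1/n}\ge f(x,t)$. Asymptotic formula in the viscosity sense: writing the formula as $u(x,t)=M_\varepsilon[u](x,t)+o(\varepsilon^2)$ where $M_\varepsilon[v](x,t)$ denotes the right-hand side expression (infimum of averages plus the $f$ term), it holds in the viscosity sense if for every $(x,t)$ and every $\phi\in C^{2,1}$ convex in the spatial variable: (i) if $u-\phi$ has a strict local minimum at $(x,t)$ with $u(x,t)=\phi(x,t)$, then $0\ge-\phi(x,t)+M_\varepsilon[\phi](x,t)+o(\varepsilon^2)$;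 (ii) if $u-\phi$ has a strict local maximum at $(x,t)$ with $u(x,t)=\phi(x,t)$, then $0\le-\phi(x,t)+M_\varepsilon[\phi](x,t)+o(\varepsilon^2)$. *)

(* Defs.v *)
From HB Require Import structures.
From mathcomp Require Import all_boot all_order all_algebra.
From mathcomp Require Import all_classical all_reals all_analysis.
Set Implicit Arguments. Unset Strict Implicit. Unset Printing Implicit Defensive.
Import Order.TTheory GRing.Theory Num.Theory.
Import numFieldNormedType.Exports.
Local Open Scope classical_set_scope.
Local Open Scope ring_scope.

Section Defs.
Variable R : realType.

Definition eucl_norm (n : nat) (y : 'rV[R]_n) : R :=
  Num.sqrt (\sum_(i < n) y 0 i ^+ 2).

Definition cons_rv (n : nat) (t : R) (y : 'rV[R]_n) : 'rV[R]_n.+1 :=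
  \row_(i < n.+1) (if unlift ord0 i is Some j then y 0 j else t).

(** Lebesgue integral over R^n, written as the iterated integral
    int dy_1 ... int dy_n g(y) (each a real-valued Lebesgue integral on R). *)
Fixpoint int_Rn (n : nat) : ('rV[R]_n -> R) -> R :=
  match n return ('rV[R]_n -> R) -> R with
  | 0 => fun g => g 0
  | m.+1 => fun g =>
      \int[@lebesgue_measure R]_(t in [set: R]) int_Rn (fun y => g (cons_rv t y))
  end.

Definition ball_avg (n : nat) (eps : R) (g : 'rV[R]_n -> R) : R :=
  int_Rn (fun y => if eucl_norm y < eps then g y else 0) /
  int_Rn (fun y : 'rV[R]_n => if eucl_norm y < eps then 1 else 0).

Definition spd (n : nat) (A : 'M[R]_n) : Prop :=
  A^T = A /\ forall v : 'rV[R]_n, v != 0 -> 0 < (v *m A *m v^T) 0 0.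

Definition mx_le_scalar (n : nat) (A : 'M[R]_n) (theta : R) : Prop :=
  forall v : 'rV[R]_n, 0 <= (v *m (theta%:M - A) *m v^T) 0 0.

Definition cyl (n : nat) (Omega : set 'rV[R]_n) (t1 t2 : R) : set ('rV[R]_n * R) :=
  [set p | Omega p.1 /\ t1 < p.2 < t2].

Definition convex_in_x (n : nat) (Omega : set 'rV[R]_n) (t1 t2 : R)
    (u : 'rV[R]_n -> R -> R) : Prop :=
  forall t x y (l : R), t1 < t < t2 ->
    (forall m : R, 0 <= m <= 1 -> Omega ((1 - m) *: x + m *: y)) ->
    0 <= l <= 1 ->
    u ((1 - l) *: x + l *: y) t <= (1 - l) * u x t + l * u y t.

Definition evec (n : nat) (i : 'I_n) : 'rV[R]_n := delta_mx 0 i.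

Definition uncurry2 (n : nat) (g : 'rV[R]_n -> R -> R) : 'rV[R]_n * R -> R :=
  fun p => g p.1 p.2.

Definition dx (n : nat) (i : 'I_n) (g : 'rV[R]_n -> R -> R) : 'rV[R]_n -> R -> R :=
  fun x t => 'D_(evec i) (fun y => g y t) x.
Definition dt (n : nat) (g : 'rV[R]_n -> R -> R) : 'rV[R]_n -> R -> R :=
  fun x t => 'D_1 (g x) t.

Definition cont_on (n : nat) (D : set ('rV[R]_n * R)) (g : 'rV[R]_n -> R -> R) :=
  forall p, D p -> {for p, continuous (uncurry2 g)}.

Definition C21 (n : nat) (D : set ('rV[R]_n * R)) (g : 'rV[R]_n -> R -> R) : Prop :=
  cont_on D g /\
  (forall i, (forall p, D p -> derivable (fun y => g y p.2) p.1 (evec i)) /\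
             cont_on D (dx i g)) /\
  (forall i j, (forall p, D p -> derivable (fun y => dx j g y p.2) p.1 (evec i)) /\
               cont_on D (dx i (dx j g))) /\
  (forall p, D p -> derivable (g p.1) p.2 1) /\ cont_on D (dt g).

Definition hessian (n : nat) (g : 'rV[R]_n -> R -> R) (x : 'rV[R]_n) (t : R) : 'M[R]_n :=
  \matrix_(i, j) dx i (dx j g) x t.

Definition strict_loc_max (n : nat) (D : set ('rV[R]_n * R))
    (w : 'rV[R]_n -> R -> R) (x : 'rV[R]_n) (t : R) : Prop :=
  exists r : R, 0 < r /\ forall y s, D (y, s) -> `|y - x| < r -> `|s - t| < r ->
    (y, s) <> (x, t) -> w y s < w x t.
Definition strict_loc_min (n : nat) (D : set ('rV[R]_n * R))
    (w : 'rV[R]_n -> R -> R) (x : 'rV[R]_n) (t : R) : Prop :=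
  exists r : R, 0 < r /\ forall y s, D (y, s) -> `|y - x| < r -> `|s - t| < r ->
    (y, s) <> (x, t) -> w x t < w y s.

Definition test_fun (n : nat) (Omega : set 'rV[R]_n) (t1 t2 : R)
    (phi : 'rV[R]_n -> R -> R) : Prop :=
  C21 (cyl Omega t1 t2) phi /\ convex_in_x Omega t1 t2 phi.

Definition visc_sol (n : nat) (Omega : set 'rV[R]_n) (t1 t2 : R)
    (f u : 'rV[R]_n -> R -> R) : Prop :=
  forall x t phi, Omega x -> t1 < t < t2 -> test_fun Omega t1 t2 phi ->
    (strict_loc_max (cyl Omega t1 t2) (fun y s => u y s - phi y s) x t ->
       u x t = phi x t ->
       dt phi x t - powR (\det (hessian phi x t)) n%:R^-1 <= f x t) /\
    (strict_loc_min (cyl Omega t1 t2) (fun y s => u y s - phi y s) x t ->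
       u x t = phi x t ->
       dt phi x t - powR (\det (hessian phi x t)) n%:R^-1 >= f x t).

Definition M_eps (n : nat) (psi : R -> R) (f : 'rV[R]_n -> R -> R) (eps : R)
    (v : 'rV[R]_n -> R -> R) (x : 'rV[R]_n) (t : R) : R :=
  let tau := n%:R / (n%:R + 2) * eps ^+ 2 in
  inf [set a | exists A : 'M[R]_n,
          [/\ spd A, \det A = 1, mx_le_scalar A (psi eps) &
              a = tau^-1 * \int[@lebesgue_measure R]_(s in `[t - tau, t]%classic)
                    ball_avg eps (fun y => v (x + y *m A) s)]]
  + n%:R / (2 * (n%:R + 2)) * f x t * eps ^+ 2.

Definition amvp_visc (n : nat) (Omega : set 'rV[R]_n) (t1 t2 : R) (psi : R -> R)
    (f u : 'rV[R]_n -> R -> R) : Prop :=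
  forall x t phi, Omega x -> t1 < t < t2 -> test_fun Omega t1 t2 phi ->
    (strict_loc_min (cyl Omega t1 t2) (fun y s => u y s - phi y s) x t ->
       u x t = phi x t ->
       (* 0 >= -phi(x,t) + M_eps[phi](x,t) + o(eps^2) *)
       (fun e => Num.max (- phi x t + M_eps psi f e phi x t) 0 / e ^+ 2)
         @ 0^'+ --> (0 : R)) /\
    (strict_loc_max (cyl Omega t1 t2) (fun y s => u y s - phi y s) x t ->
       u x t = phi x t ->
       (* 0 <= -phi(x,t) + M_eps[phi](x,t) + o(eps^2) *)
       (fun e => Num.max (- (- phi x t + M_eps psi f e phi x t)) 0 / e ^+ 2)
         @ 0^'+ --> (0 : R)).

End Defs.

(* Main.v *)
(** Both notions are tested against the same functions [phi], so it suffices to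
    show, for [phi] of class C^{2,1} and convex in space, that
      M_eps[phi] = phi + n/(2(n+2)) eps^2 ((det D^2 phi)^{1/n} - phi_t + f) + o(eps^2).
    On the ball of radius [eps] first moments vanish and the second moments are
    [eps^2/(n+2)] times the identity, so a quadratic model [K] of [phi] contributes
    [eps^2/(2(n+2)) tr (A K A^T)], and the backward time average contributes
    [- n/(2(n+2)) eps^2 phi_t].  By Hadamard's inequality and AM-GM,
    [tr (A H A^T) >= n (det H)^{1/n}] for every positive definite [A] of determinant 1,
    with near equality for a multiple of [(H + d I)^{-1/2}], which is admissible as
    soon as [psi eps] is large.  The lower bound has to hold uniformly in
    [A <= psi eps]; since [eps psi(eps) -> 0], it follows from
    [D^2 phi >= (1 - th) H] near the point if [H = D^2 phi] is invertible there, and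
    from convexity if [det H = 0]. *)

Require Import Defs.
From HB Require Import structures.
From mathcomp Require Import all_boot all_order all_algebra.
From mathcomp Require Import all_classical all_reals all_analysis.
From mathcomp Require Import measurable_realfun ring lra.
From mathcomp.real_closed Require complex.
Import Order.TTheory GRing.Theory Num.Theory.
Import numFieldNormedType.Exports.
Local Open Scope classical_set_scope.
Local Open Scope ring_scope.

Set Implicit Arguments. Unset Strict Implicit.

(** The delicate point is that [A] may be as large as [psi eps]: a Taylor error [eta * |y A|^2] then
    averages to something of order [eta * eps^2 * psi(eps)^2], which need not be small against
    [eps^2]. The lower bound therefore makes the error relative: for positive definite [H] it is a
    fraction [th] of the quadratic form of [H] itself, and the trace inequality absorbs it for all
    [A] at once. The limit of [eps * psi(eps)] keeps [x + y A] inside the Taylor neighbourhood. In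
    the upper bound one fixed [A] suffices, so absolute errors are harmless there. The other
    obstacle is the integral: over R^n it is an iterated real-valued integral, so additivity and
    monotonicity require every slice integral to be integrable in the next variable. Continuity and
    boundedness inside the ball give this and pass to slices. Moments come from explicit primitives
    in one variable, relative to a ball volume whose constant is never computed. *)

Lemma poly_interpolation (F : fieldType) (s : seq F) (g : F -> F) :
  exists p : {poly F}, forall x, x \in s -> p.[x] = g x.
Proof.
elim: s => [|a s [p hp]]; first by exists 0.
have [as_|as_] := boolP (a \in s).
  by exists p => x; rewrite inE => /orP[/eqP->|]; apply: hp.
(* Newton's form: [q] vanishes at the earlier nodes, so adding a multiple of it corrects the value
   at [a] alone. *)
pose q := \prod_(b <- s) ('X - b%:P).
have q0 (x : F) : x \in s -> q.[x] = 0.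
  by move=> xs; apply/rootP; rewrite root_prod_XsubC.
have qa : q.[a] != 0 by apply: contra as_ => /eqP/rootP; rewrite root_prod_XsubC.
exists (p + ((g a - p.[a]) / q.[a])%:P * q) => x; rewrite inE hornerD hornerM hornerC.
have [-> _|_] := eqVneq x a; first by rewrite divfK // addrC subrK.
by rewrite orFb => xs; rewrite (q0 x) // mulr0 addr0 hp.
Qed.

(** * Diagonalization of real symmetric matrices *)

Module RealSpectral.
Import complex.
Section RealSpectral.
Variables (R : rcfType) (n : nat).

(* Diagonalise over [R[i]] and transfer polynomial identities back to [R]. *)
Lemma symmetric_spectrum (H : 'M[R]_n.+1) : H^T = H ->
  exists s : seq R, (forall a, a \in s -> eigenvalue H a) /\
    forall p : {poly R}, (forall a, a \in s -> p.[a] = 0) -> horner_mx H p = 0.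
Proof.
move=> Hs.
pose f := real_complex R : {rmorphism R -> R[i]}.
pose Hc := map_mx f H.
have Hh : Hc \is hermsymmx.
  apply: realsym_hermsym.
    apply/is_hermitianmxP; rewrite expr0 scale1r.
    by apply/matrixP=> i j; rewrite !mxE -[in LHS]Hs mxE.
  by apply/mxOverP=> i j; rewrite mxE; apply/complex_realP; exists (H i j).
have [P [d [Pu eH Dr]]] : exists P, exists d, [/\ P \in unitmx,
    Hc = invmx P *m diag_mx d *m P & forall i, d 0 i \is Num.real].
  exists (spectralmx Hc), (spectral_diag Hc); split; first exact: spectral_unit.
    exact/orthomx_spectralP/hermitian_normalmx.
  by move=> i; apply/mxOverP/hermitian_spectral_diag_real.
have eHp (q : {poly R[i]}) :
    horner_mx Hc q = invmx P *m diag_mx (map_mx (horner q) d) *m P.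
  by rewrite eH -horner_mx_diag; apply: horner_mx_uconjC.
have dE i : d 0 i = f (complex.Re (d 0 i)) by rewrite /f /= complex.RRe_real // Dr.
have ed i : eigenvalue H (complex.Re (d 0 i)).
  rewrite eigenvalue_root_char -(fmorph_root f) map_char_poly.
  rewrite -eigenvalue_root_char -dE.
  apply/eigenvalueP; exists (row i P).
    have : P *m Hc = diag_mx d *m P.
      by rewrite [in LHS]eH !mulmxA mulmxV // mul1mx.
    move=> /(congr1 (row i)); rewrite !row_mul => ->.
    by rewrite row_diag_mx -scalemxAl -rowE.
  apply/eqP => r0; have := congr1 (row i) (mulmxV Pu).
  rewrite row_mul r0 mul0mx row1 => /matrixP/(_ 0 i).
  by rewrite !mxE !eqxx => /eqP; rewrite eq_sym oner_eq0.
exists [seq complex.Re (d 0 i) | i <- enum 'I_n.+1]; split.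
  by move=> a /mapP[i _ ->].
(* The embedding [f] is injective, so annihilation can be tested over [R[i]], where [p] acts on the
   diagonal entries separately. *)
move=> p hp; suff e0 : map_mx f (horner_mx H p) = 0.
  apply/matrixP=> i j; apply: (fmorph_inj f).
  by move/matrixP/(_ i j): e0; rewrite !mxE rmorph0.
rewrite map_horner_mx -/Hc eHp.
suff -> : map_mx (horner (map_poly f p)) d = 0.
  by rewrite (_ : diag_mx 0 = 0) ?mulmx0 ?mul0mx //; apply/matrixP=> i j;
    rewrite !mxE mul0rn.
apply/matrixP=> i j; rewrite ord1 !mxE dE horner_map hp ?rmorph0 //.
by apply/mapP; exists j; rewrite ?mem_enum.
Qed.

End RealSpectral.
End RealSpectral.

(** * Quadratic forms, determinants and traces of positive matrices *)

Section QuadraticForms.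
Variable R : realType.
Implicit Types n : nat.

Definition sqn n (y : 'rV[R]_n) : R := \sum_(i < n) y 0 i ^+ 2.

Definition bform n (K : 'M[R]_n) (v w : 'rV[R]_n) : R := (v *m K *m w^T) 0 0.

Definition psdmx n (K : 'M[R]_n) : Prop :=
  K^T = K /\ forall v, 0 <= bform K v v.

Lemma sqnE n (v : 'rV[R]_n) : sqn v = (v *m v^T) 0 0.
Proof. by rewrite mxE; apply: eq_bigr => i _; rewrite mxE expr2. Qed.

Lemma sqn_ge0 n (v : 'rV[R]_n) : 0 <= sqn v.
Proof. by apply: sumr_ge0 => i _; apply: sqr_ge0. Qed.

Lemma sqn_eq0 n (v : 'rV[R]_n) : (sqn v == 0) = (v == 0).
Proof.
apply/idP/eqP => [|->]; last by rewrite /sqn big1 // => i _; rewrite mxE expr0n.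
rewrite psumr_eq0 => [|i _]; last exact: sqr_ge0.
move=> /allP h; apply/matrixP => i j; rewrite ord1 mxE.
by apply/eqP; rewrite -sqrf_eq0; apply: h; rewrite mem_index_enum.
Qed.

Lemma sqn_gt0 n (v : 'rV[R]_n) : (0 < sqn v) = (v != 0).
Proof. by rewrite lt0r sqn_eq0 sqn_ge0 andbT. Qed.

Lemma bformE n (K : 'M[R]_n) v w :
  bform K v w = \sum_i \sum_j v 0 i * K i j * w 0 j.
Proof.
rewrite /bform mxE exchange_big /=; apply: eq_bigr => j _.
by rewrite !mxE mulr_suml.
Qed.

Lemma bformDl n (K : 'M[R]_n) u v w : bform K (u + v) w = bform K u w + bform K v w.
Proof. by rewrite /bform !mulmxDl mxE. Qed.
Lemma bformDr n (K : 'M[R]_n) u v w : bform K u (v + w) = bform K u v + bform K u w.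
Proof. by rewrite /bform linearD /= mulmxDr mxE. Qed.
Lemma bformZl n (K : 'M[R]_n) a v w : bform K (a *: v) w = a * bform K v w.
Proof. by rewrite /bform -!scalemxAl mxE. Qed.
Lemma bformZr n (K : 'M[R]_n) a v w : bform K v (a *: w) = a * bform K v w.
Proof. by rewrite /bform linearZ /= -scalemxAr mxE. Qed.
Lemma bformC n (K : 'M[R]_n) v w : K^T = K -> bform K v w = bform K w v.
Proof.
move=> Ks; rewrite /bform -[v *m K *m w^T]trmxK [in LHS]mxE.
by rewrite !trmx_mul trmxK Ks mulmxA.
Qed.
Lemma bform_mxD n (K L : 'M[R]_n) v w : bform (K + L) v w = bform K v w + bform L v w.
Proof. by rewrite /bform mulmxDr mulmxDl mxE. Qed.
Lemma bform_mxZ n (K : 'M[R]_n) a v w : bform (a *: K) v w = a * bform K v w.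
Proof. by rewrite /bform -scalemxAr -scalemxAl mxE. Qed.
Lemma bform_mxN n (K : 'M[R]_n) v w : bform (- K) v w = - bform K v w.
Proof. by rewrite -scaleN1r bform_mxZ mulN1r. Qed.
Lemma bform_scalar n a (v : 'rV[R]_n) : bform a%:M v v = a * sqn v.
Proof. by rewrite /bform mul_mx_scalar -scalemxAl mxE sqnE. Qed.
Lemma bform_congr n (K A : 'M[R]_n) v : bform (A *m K *m A^T) v v = bform K (v *m A) (v *m A).
Proof. by rewrite /bform trmx_mul !mulmxA. Qed.

Lemma spd_psd n (K : 'M[R]_n) : spd K -> psdmx K.
Proof.
move=> [Ks Kp]; split=> // v; have [->|v0] := eqVneq v 0; last exact/ltW/Kp.
by rewrite /bform !mul0mx mxE.
Qed.

Lemma bform_CauchySchwarz n (K : 'M[R]_n) v w : psdmx K ->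
  bform K v w ^+ 2 <= bform K v v * bform K w w.
Proof.
move=> [Ks Kp].
have q s : 0 <= bform K v v + 2 * s * bform K v w + s ^+ 2 * bform K w w.
  have := Kp (v + s *: w).
  rewrite bformDl !bformDr !bformZl !bformZr (bformC w) //; lra.
move: (Kp v) (Kp w) q; move: (bform K v v) (bform K v w) (bform K w w) => a b c a0 c0 q.
(* If [c = 0] the polynomial [q] is affine in [s], and the chosen [s] would make it equal to
   [- a - 2] unless [b = 0]. Otherwise its minimum, at [- b / c], gives the discriminant
   inequality. *)
have [ce|cn] := eqVneq c 0.
  have := q (- (a + 1) / b); rewrite ce; have [->|bn] := eqVneq b 0; first lra.
  rewrite mulr0 addr0 (_ : 2 * (- (a + 1) / b) * b = - 2 * (a + 1)); last by field.
  lra.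
have cp : 0 < c by rewrite lt0r cn.
have := q (- b / c); rewrite -(pmulr_rge0 _ cp).
suff -> : c * (a + 2 * (- b / c) * b + (- b / c) ^+ 2 * c) = a * c - b ^+ 2.
  by rewrite subr_ge0.
by field.
Qed.

(** Cauchy-Schwarz for the form of [A], applied to [y] and [y A], bounds [|y A|^4] by
    [th^2 |y|^2 |y A|^2]; no eigenvalues are needed. *)
Lemma sqn_mulmx_le n (A : 'M[R]_n) th y : spd A -> mx_le_scalar A th ->
  sqn (y *m A) <= th ^+ 2 * sqn y.
Proof.
move=> As Ale.
have le v : bform A v v <= th * sqn v.
  have := Ale v; rewrite -/(bform _ v v) bform_mxD bform_scalar.
  by rewrite bform_mxN subr_ge0.
have := bform_CauchySchwarz y (y *m A) (spd_psd As).
have -> : bform A y (y *m A) = sqn (y *m A) by rewrite sqnE.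
have l1 := le y; have l2 := le (y *m A).
have [_ /(_ y) p1] := spd_psd As; have [_ /(_ (y *m A)) p2] := spd_psd As.
move: l1 l2 p1 p2 (sqn_ge0 (y *m A)) (sqn_ge0 y).
move: (sqn _) (sqn _) (bform _ _ _) (bform _ _ _) => a b c d l1 l2 p1 p2.
rewrite le0r => /orP[/eqP->|a0] b0; first by rewrite mulr_ge0 ?sqr_ge0.
move=> h; have : a ^+ 2 <= (th * b) * (th * a).
  by apply: le_trans h _; apply: ler_pM.
by rewrite expr2 !mulrA ler_pM2r // expr2 => /le_trans; apply; lra.
Qed.

Lemma bform_entry_bound n (K : 'M[R]_n) (eta : R) (v : 'rV[R]_n) :
  (forall i j, `|K i j| <= eta) -> `|bform K v v| <= eta * n%:R * sqn v.
Proof.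
move=> hK; rewrite bformE.
have le : `|\sum_i \sum_j v 0 i * K i j * v 0 j| <=
    \sum_i \sum_j eta * (2^-1 * (v 0 i ^+ 2 + v 0 j ^+ 2)).
  apply: le_trans (ler_norm_sum _ _ _) _; apply: ler_sum => i _.
  apply: le_trans (ler_norm_sum _ _ _) _; apply: ler_sum => j _.
  rewrite mulrAC normrM mulrC ler_pM // normrM.
  rewrite -(real_normK (num_real (v 0 i))) -(real_normK (num_real (v 0 j))).
  have := sqr_ge0 (`|v 0 i| - `|v 0 j|); rewrite !expr2; lra.
apply: le_trans le _; rewrite le_eqVlt; apply/orP; left; apply/eqP.
under eq_bigr do rewrite -mulr_sumr -mulr_sumr big_split /= sumr_const card_ord -/(sqn v).
rewrite -mulr_sumr -mulr_sumr big_split /= sumr_const card_ord.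
rewrite -sumrMnl -mulr_natl -[_ *+ n]mulr_natl sumrMnl -/(sqn v) -[_ *+ n]mulr_natl.
by field.
Qed.

(** An isotropic vector of a semidefinite form lies in its kernel, by Cauchy-Schwarz against
    [v K]. *)
Lemma psd_unit_spd n (K : 'M[R]_n) : psdmx K -> \det K != 0 -> spd K.
Proof.
move=> Kpsd dK; have [Ks Kp] := Kpsd; split=> // v v0; rewrite lt0r Kp andbT.
apply: contra v0 => /eqP v0.
have := bform_CauchySchwarz v (v *m K) Kpsd.
rewrite [bform K v v]v0 mul0r => h.
have : bform K v (v *m K) == 0 by rewrite -sqrf_eq0 eq_le h sqr_ge0.
rewrite /bform -sqnE sqn_eq0 => /eqP vK0.
have Ku : K \in unitmx by rewrite unitmxE unitfE.
by rewrite -(mulmxK Ku v) vK0 mul0mx.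
Qed.

Lemma psd_add_scalar_spd n (K : 'M[R]_n) d : psdmx K -> 0 < d -> spd (K + d%:M).
Proof.
move=> [Ks Kp] d0; split; first by rewrite linearD /= Ks tr_scalar_mx.
move=> v v0; rewrite -/(bform _ v v) bform_mxD bform_scalar.
by rewrite ltr_wpDl // mulr_gt0 // sqn_gt0.
Qed.

Lemma spd_congr n (K A : 'M[R]_n) : spd K -> A \in unitmx -> spd (A *m K *m A^T).
Proof.
move=> [Ks Kp] Au; split; first by rewrite !trmx_mul trmxK Ks mulmxA.
move=> v v0; rewrite -/(bform _ v v) bform_congr; apply: Kp.
by apply: contra v0 => /eqP v0; rewrite -(mulmxK Au v) v0 mul0mx.
Qed.

Lemma spd1 n : spd (1%:M : 'M[R]_n).
Proof.
split; first exact: trmx1.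
by move=> v v0; rewrite -/(bform _ v v) bform_scalar mul1r sqn_gt0.
Qed.

(* Induction on the dimension through the Schur complement of the corner entry. *)
Lemma spd_Hadamard n (K : 'M[R]_n) : spd K ->
  0 < \det K /\ \det K <= \prod_i K i i.
Proof.
elim: n => [|n IH] in K *; first by rewrite det_mx00 big_ord0.
move: K; change n.+1 with (1 + n)%N => K [Ks Kp].
pose a := K 0 0; pose b := ursubmx K; pose D := drsubmx K.
have eK : K = block_mx a%:M b b^T D.
  rewrite -[LHS]submxK; congr block_mx.
    by rewrite [LHS]mx11_scalar /a !mxE lshift0.
  by rewrite /b trmx_ursub Ks.
have a0 : 0 < a.
  have := Kp (delta_mx 0 0); rewrite -rowE trmx_delta -colE !mxE; apply.
  apply/eqP => /matrixP/(_ 0 0); rewrite !mxE !eqxx => /eqP.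
  by rewrite oner_eq0.
pose S := D - a^-1 *: (b^T *m b).
have Sspd : spd S.
  split.
    have Ds : D^T = D by rewrite /D trmx_drsub Ks.
    by rewrite /S linearB linearZ /= Ds trmx_mul trmxK.
  (* The first coordinate of [v] minimizes the form of [K] over vectors ending in [w]; the minimum
     is the form of [S] at [w]. *)
  move=> w w0; pose v : 'rV_(1 + n) := row_mx (- a^-1 *: (w *m b^T)) w.
  have vK : v *m K = row_mx 0 (w *m S).
    rewrite eK /v mul_row_block; congr row_mx.
      by rewrite mul_mx_scalar scalerA mulrN divff ?gt_eqF // scaleN1r addNr.
    by rewrite /S mulmxBr -scalemxAr -scalemxAl mulmxA addrC scaleNr.
  have := Kp v; rewrite vK tr_row_mx mul_row_col mul0mx add0r; apply.
  apply: contra w0 => /eqP v0; have := congr1 rsubmx v0.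
  by rewrite row_mxKr linear0 => ->.
have dK : \det K = a * \det S.
  (* [L] is the unipotent elimination step that clears the column below the corner. *)
  pose L : 'M[R]_(1 + n) := block_mx 1%:M 0 (- a^-1 *: b^T) 1%:M.
  have -> : \det K = \det (L *m K) by rewrite det_mulmx det_lblock !det1 !mul1r.
  rewrite eK mulmx_block !mul1mx !mul0mx !addr0 mul_mx_scalar scalerA mulrN.
  rewrite divff ?gt_eqF // scaleN1r addNr det_ublock det_scalar1.
  by rewrite -scalemxAl scaleNr addrC.
have [S0 Sle] := IH S Sspd; split; first by rewrite dK mulr_gt0.
rewrite dK big_ord_recl ler_pM2l //.
apply: le_trans Sle _; apply: ler_prod => i _; apply/andP; split.
  have := Sspd.2 (delta_mx 0 i); rewrite -rowE trmx_delta -colE !mxE => h; apply: ltW; apply: h.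
  apply/eqP => /matrixP/(_ 0 i); rewrite !mxE !eqxx => /eqP.
  by rewrite oner_eq0.
(* The diagonal of [b^T *m b] is nonnegative, so passing to the Schur complement only lowers
   diagonal entries. *)
rewrite /S !mxE !rshift1 lerBlDr lerDl mulr_ge0 ?invr_ge0 ?(ltW a0) //.
by apply: sumr_ge0 => j _; rewrite !mxE -expr2 sqr_ge0.
Qed.

Lemma spd_det_root_le_trace n (K : 'M[R]_n) : (0 < n)%N -> spd K ->
  n%:R * (\det K) `^ n%:R^-1 <= \tr K.
Proof.
move=> n0 Ks; have [d0 dle] := spd_Hadamard Ks.
have n0' : (0 : R) < n%:R by rewrite ltr0n.
have Kii i : 0 <= K i i.
  have := Ks.2 (delta_mx 0 i); rewrite -rowE trmx_delta -colE !mxE => h; apply: ltW; apply: h.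
  apply/eqP => /matrixP/(_ 0 i); rewrite !mxE !eqxx => /eqP.
  by rewrite oner_eq0.
have tr0 : 0 <= \tr K by apply: sumr_ge0.
rewrite mulrC -ler_pdivlMr //.
have : \det K <= (\tr K / n%:R) ^+ n.
  apply: le_trans dle _.
  have := leif_AGM (A := 'I_n) (E := fun i => K i i) (fun i _ => Kii i).
  by rewrite card_ord => -[].
move=> /(ge0_ler_powR (r := n%:R^-1)) => /(_ _ _ _)/le_trans; apply.
- by rewrite invr_ge0 ltW.
- by rewrite nnegrE ltW.
- by rewrite nnegrE exprn_ge0 // divr_ge0 // ltW.
rewrite -powR_mulrn ?divr_ge0 ?(ltW n0') // -powRrM divff ?gt_eqF //.
by rewrite powRr1 // divr_ge0 // ltW.
Qed.

(* [A] is the inverse square root of [K]; as the square of the polynomial in [K]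
   interpolating [lambda^(-1/4)], it is positive definite. *)
Lemma spd_inv_sqrt n (K : 'M[R]_n) : spd K ->
  exists A, spd A /\ A *m K *m A = 1%:M.
Proof.
case: n K => [|n] K Ks.
  by exists 1%:M; split; [exact: spd1 | rewrite [LHS]flatmx0 [RHS]flatmx0].
have [Ksym Kp] := Ks.
have ev_gt0 a : eigenvalue K a -> 0 < a.
  move=> /eigenvalueP[v vK v0]; have := Kp v v0.
  by rewrite vK -scalemxAl mxE -sqnE pmulr_lgt0 // sqn_gt0.
have [s [sev sann]] := RealSpectral.symmetric_spectrum Ksym.
have [r rE] := poly_interpolation s (fun a => a `^ (- 4^-1)).
pose B := horner_mx K r.
(* At an eigenvalue [a > 0] one has [(a^(-1/4))^4 * a = 1], so [r ^+ 4 * 'X - 1] vanishes on the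
   spectrum and hence at [K]. *)
have BKE : B ^+ 4 * K = 1.
  have : horner_mx K (r ^+ 4 * 'X - 1) = 0.
    apply: sann => a sa; have a0 := ev_gt0 _ (sev _ sa).
    rewrite hornerD hornerN hornerC hornerM hornerX horner_exp rE //.
    rewrite -powR_mulrn ?powR_ge0 // -powRrM mulNr mulVf // powRN powRr1 ?ltW //.
    by rewrite mulVf ?gt_eqF // subrr.
  by rewrite rmorphB rmorphM rmorphXn rmorph1 /= horner_mx_X => /subr0_eq.
have comm (p q : {poly R}) : horner_mx K p * horner_mx K q = horner_mx K q * horner_mx K p.
  by rewrite -!rmorphM mulrC.
have BK : B * K = K * B by have := comm r 'X; rewrite horner_mx_X.
have Bs : B^T = B.
  rewrite /B; elim/poly_ind: (r) => [|p c IHp]; first by rewrite rmorph0 trmx0.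
  rewrite rmorphD rmorphM /= horner_mx_X horner_mx_C linearD /= tr_scalar_mx.
  rewrite trmx_mul Ksym IHp; congr (_ + _).
  by have := comm 'X p; rewrite horner_mx_X.
have Bu : B \in unitmx.
  have : B *m (B ^+ 3 * K) = 1%:M by move: BKE; rewrite exprS -mulrA.
  by case/mulmx1_unit.
exists (B *m B); split; last first.
  rewrite -[1%:M]BKE -[LHS]/(B * B * K * (B * B)).
  by rewrite -mulrA (mulrA K) -BK -(mulrA B K) -BK !exprS expr0 mulr1 !mulrA.
split; first by rewrite trmx_mul Bs.
move=> v v0; rewrite mulmxA -mulmxA -{2}Bs -trmx_mul -sqnE sqn_gt0.
by apply: contra v0 => /eqP v0; rewrite -(mulmxK Bu v) v0 mul0mx.
Qed.

Lemma mulmx_sqn_bound n (A : 'M[R]_n) :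
  exists2 C : R, 0 < C & forall v, sqn (v *m A) <= C * sqn v.
Proof.
pose K := A *m A^T.
pose eta := \sum_i \sum_j `|K i j|.
have eta0 : 0 <= eta by apply: sumr_ge0 => i _; apply: sumr_ge0.
exists (eta * n%:R + 1); first by rewrite ltr_wpDl // mulr_ge0.
move=> v; have : `|bform K v v| <= eta * n%:R * sqn v.
  apply: bform_entry_bound => i j; rewrite /eta (bigD1 i) //= (bigD1 j) //=.
  by rewrite -addrA lerDl addr_ge0 ?sumr_ge0 // => k _; apply: sumr_ge0.
have -> : bform K v v = sqn (v *m A) by rewrite /bform sqnE trmx_mul !mulmxA.
rewrite ger0_norm ?sqn_ge0 // => /le_trans; apply.
by rewrite mulrDl mul1r lerDl sqn_ge0.
Qed.

(** Write [v = w A] with [A K A = 1]. The form of [K] at [v] is then [|w|^2], while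
    [|v|^2 <= C |w|^2]; [C^-1] replaces the least eigenvalue. *)
Lemma spd_coercive n (K : 'M[R]_n) : spd K ->
  exists2 l : R, 0 < l & forall v, l * sqn v <= bform K v v.
Proof.
move=> Ks; have [A [As AKA]] := spd_inv_sqrt Ks.
have AT : A^T = A := As.1.
have [C C0 hC] := mulmx_sqn_bound A.
exists C^-1; first by rewrite invr_gt0.
have Au : A \in unitmx by move: AKA; rewrite -mulmxA => /mulmx1_unit[].
move=> v; rewrite ler_pdivrMl // -{1}(mulmxKV Au v).
apply: le_trans (hC _) _; rewrite ler_pM2l //.
rewrite le_eqVlt; apply/orP; left; apply/eqP.
rewrite -{2 3}(mulmxKV Au v) -bform_congr AT AKA bform_scalar mul1r //.
Qed.

(** Makes a fixed matrix admissible for all small [eps], since [psi] tends to infinity. The constant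
    [C + 1] is a root-free majorant of the operator bound [sqrt C]. *)
Lemma spd_le_scalar n (A : 'M[R]_n) : spd A ->
  exists C : R, forall th, C <= th -> mx_le_scalar A th.
Proof.
move=> As; have [C C0 hC] := mulmx_sqn_bound A.
exists (C + 1) => th le v.
rewrite -/(bform _ v v) bform_mxD bform_scalar bform_mxN.
have -> : bform A v v = bform 1%:M (v *m A) v by rewrite /bform mulmx1.
have := bform_CauchySchwarz (v *m A) v (spd_psd (@spd1 n)).
rewrite !bform_scalar !mul1r => h.
suff : bform 1%:M (v *m A) v <= th * sqn v by lra.
have v0 := sqn_ge0 v.
apply: (le_trans (y := (C + 1) * sqn v)); last by rewrite ler_wpM2r.
apply: le_trans (ler_norm _) _.
rewrite -(ler_pXn2r (n := 2)) ?nnegrE ?mulr_ge0 ?addr_ge0 ?(ltW C0) //.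
rewrite real_normK ?num_real //; apply: le_trans h _; rewrite exprMn !expr2 mulrA ler_wpM2r //.
apply: le_trans (hC v) _; rewrite ler_wpM2r //; nra.
Qed.

(* Perturbing by [d%:M] covers degenerate [H], whose optimal [A] does not exist. *)
Lemma near_optimal_congr n (H : 'M[R]_n) (dl : R) : (0 < n)%N -> psdmx H -> 0 < dl ->
  exists A, [/\ spd A, \det A = 1 &
    \tr (A *m H *m A^T) <= n%:R * (\det H) `^ n%:R^-1 + dl].
Proof.
move=> n0 Hp dl0.
have n0' : (0 : R) < n%:R by rewrite ltr0n.
set D := _ `^ _.
have D0 : 0 <= D := powR_ge0 _ _.
have DE : D ^+ n = \det H.
  have dH : 0 <= \det H.
    have [->//|dH] := eqVneq (\det H) 0.
    by have [/ltW] := spd_Hadamard (psd_unit_spd Hp dH).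
  by rewrite -powR_mulrn // -powRrM mulVf ?gt_eqF // powRr1.
(* The determinant of [H + d%:M] is a polynomial in [d], hence continuous. The margin [dl / n%:R]
   becomes [dl] once the trace bound multiplies it by [n]. *)
have [d d0 dlt] : exists2 d, 0 < d & \det (H + d%:M) < (D + dl / n%:R) ^+ n.
  pose p := \det (map_mx polyC H + 'X%:M).
  have pE d : p.[d] = \det (H + d%:M).
    rewrite -horner_evalE -det_map_mx map_mxD /= map_scalar_mx /= horner_evalE hornerX.
    by rewrite -map_mx_comp map_mx_id // => x; rewrite /= /horner_eval hornerC.
  have lt0 : p.[0] < (D + dl / n%:R) ^+ n.
    rewrite pE (_ : 0%:M = 0) ?addr0 ?raddf0 // -DE ltr_pXn2r ?nnegrE //.
      by rewrite ltrDl divr_gt0.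
    by rewrite addr_ge0 // divr_ge0 // ltW.
  have e0 : 0 < (D + dl / n%:R) ^+ n - p.[0] by rewrite subr_gt0.
  have /cvgrPdist_lt/(_ _ e0)/nbhs_ballP[e /= e1 he] :
    (horner (p : {poly R})) x @[x --> (0 : R)] --> p.[0] by exact: continuous_horner.
  exists (e / 2); first by rewrite divr_gt0.
  have /he : ball (0 : R) e (e / 2).
    rewrite /ball /= sub0r normrN gtr0_norm ?divr_gt0 //.
    by rewrite ltr_pdivrMr // ltr_pMr // ltr1n.
  by rewrite ltr_distlC -pE => /andP[_]; rewrite addrC subrK.
have Hd := psd_add_scalar_spd Hp d0.
have [A0 [A0s A0E]] := spd_inv_sqrt Hd.
have [a0 _] := spd_Hadamard A0s; have [Dd0 _] := spd_Hadamard Hd.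
set Dd := \det (H + d%:M) in dlt Dd0.
have aE : \det A0 ^+ 2 * Dd = 1.
  by have := congr1 determinant A0E; rewrite !det_mulmx det1 -/Dd => <-; ring.
(* The determinant of [A0] is [Dd^(-1/2)]; scaling by the [2n]-th root of [Dd] normalizes it to
   1. *)
pose k := Dd `^ (2 * n%:R)^-1.
have k0 : 0 < k by apply: powR_gt0.
have kE : k ^+ (2 * n) = Dd.
  rewrite -powR_mulrn ?(ltW k0) // natrM -powRrM mulVf ?powRr1 ?(ltW Dd0) //.
  by rewrite mulf_neq0 ?gt_eqF.
have A0T : A0^T = A0 := A0s.1.
exists (k *: A0); split.
- split; first by rewrite linearZ /= A0T.
  move=> v v0; rewrite -/(bform _ v v) bform_mxZ mulr_gt0 //; exact: A0s.2.
- apply/eqP; rewrite detZ -(@pexpr_eq1 _ _ 2) ?mulr_ge0 ?exprn_ge0 ?ltW //.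
  by rewrite exprMn -exprM mulnC kE mulrC aE.
rewrite linearZ /= A0T -scalemxAr -!scalemxAl scalerA linearZ /=.
(* Restoring [d%:M] only raises the trace, and [A0] carries the perturbed matrix to the identity, of
   trace [n]. *)
have tle : \tr (A0 *m H *m A0) <= n%:R.
  have <- : \tr (A0 *m (H + d%:M) *m A0) = n%:R by rewrite A0E mxtrace1.
  rewrite mulmxDr mulmxDl linearD /= lerDl mul_mx_scalar -scalemxAl linearZ /=.
  rewrite mulr_ge0 ?(ltW d0) //; apply: sumr_ge0 => i _; rewrite mxE.
  by apply: sumr_ge0 => j _; rewrite -{2}A0T [A0^T _ _]mxE -expr2 sqr_ge0.
apply: (le_trans (y := k * k * n%:R)); first by rewrite ler_wpM2l // mulr_ge0 // ltW.
rewrite mulrC -ler_pdivlMl // mulrDr mulKf ?gt_eqF // (mulrC _ dl) -expr2.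
rewrite -(ler_pXn2r n0) ?nnegrE ?exprn_ge0 ?(ltW k0) //; last first.
  by rewrite addr_ge0 // divr_ge0 // ltW.
by rewrite -exprM kE ltW.
Qed.

Lemma trace_congr_ge n (H A : 'M[R]_n) : (0 < n)%N -> spd H -> spd A -> \det A = 1 ->
  n%:R * (\det H) `^ n%:R^-1 <= \tr (A *m H *m A^T).
Proof.
move=> n0 Hs As dA.
have Au : A \in unitmx by rewrite unitmxE dA unitr1.
have := spd_det_root_le_trace n0 (spd_congr Hs Au).
by rewrite !det_mulmx det_tr dA mul1r mulr1.
Qed.

End QuadraticForms.

(** * Integrals over balls by slicing: bounds and dominated convergence *)

Section SlicedBallIntegral.
Variable R : realType.
Local Notation mu := (@lebesgue_measure R).

Lemma cvg_rV (T : Type) (F : set_system T) (FF : Filter F) n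
    (f : T -> 'rV[R]_n) (l : 'rV[R]_n) :
  (forall i, f x 0 i @[x --> F] --> l 0 i) -> f x @[x --> F] --> l.
Proof.
move=> h; apply/cvg_ballP => e e0.
have : \forall x \near F, forall i, ball (l 0 i) e (f x 0 i).
  by apply: filter_forall => i; have /cvg_ballP := h i; apply.
apply: filterS => x hx; split=> // i j; rewrite ord1; exact: hx.
Qed.

Lemma sqn_cons_rv m (t : R) (y : 'rV[R]_m) : sqn (cons_rv t y) = t ^+ 2 + sqn y.
Proof.
rewrite /sqn big_ord_recl mxE unlift_none; congr (_ + _).
by apply: eq_bigr => i _; rewrite mxE liftK.
Qed.

Lemma cons_rv0 m (t : R) (y : 'rV[R]_m) : cons_rv t y 0 ord0 = t.
Proof. by rewrite mxE unlift_none. Qed.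

Lemma cons_rvS m (t : R) (y : 'rV[R]_m) i : cons_rv t y 0 (lift ord0 i) = y 0 i.
Proof. by rewrite mxE liftK. Qed.

Lemma cvg_cons_rv (T : Type) (F : set_system T) (FF : Filter F) m
    (s : T -> R) (y : T -> 'rV[R]_m) (s0 : R) (y0 : 'rV[R]_m) :
  s x @[x --> F] --> s0 -> y x @[x --> F] --> y0 ->
  cons_rv (s x) (y x) @[x --> F] --> cons_rv s0 y0.
Proof.
move=> hs hy; apply: cvg_rV => i; case: (unliftP ord0 i) => [j|] ->.
  rewrite cons_rvS; under eq_fun do rewrite cons_rvS.
  have : {for y0, continuous (fun z : 'rV[R]_m => z 0 j)} by apply: coord_continuous.
  by apply: cvg_comp.
by rewrite cons_rv0; under eq_fun do rewrite cons_rv0.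
Qed.

(* Indexing the ball by its squared radius turns slicing into [q - t ^+ 2]. *)
Definition ballint m (q : R) (g : 'rV[R]_m -> R) : R :=
  int_Rn (fun y => if sqn y < q then g y else 0).

(** Nothing is asked outside the open ball, since a test function is controlled only where [x + y A]
    stays near [x]. The bound [M] is explicit so that a sequence of integrands can share it. *)
Definition cbounded m (q M : R) (g : 'rV[R]_m -> R) : Prop :=
  (forall y, sqn y < q -> {for y, continuous g}) /\
  (forall y, sqn y < q -> `|g y| <= M).

Lemma ballintS m q (g : 'rV[R]_m.+1 -> R) :
  ballint q g =
  \int[mu]_t ballint (q - t ^+ 2) (fun y => g (cons_rv t y)).
Proof.
apply: eq_Rintegral => t _; rewrite /ballint; congr (int_Rn _).
by apply/funext => y; rewrite sqn_cons_rv ltrBrDl.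
Qed.

Lemma int_Rn0 m : int_Rn (fun _ : 'rV[R]_m => 0 : R) = 0.
Proof.
elim: m => //= m IH; under eq_Rintegral do rewrite IH.
by rewrite Rintegral_cst // mul0r.
Qed.

Lemma ballint_le0 m q (g : 'rV[R]_m -> R) : q <= 0 -> ballint q g = 0.
Proof.
move=> q0; rewrite -[RHS](int_Rn0 m); congr int_Rn; apply/funext => y.
by rewrite ltNge (le_trans q0) // sqn_ge0.
Qed.

Lemma eq_ballint m q (g1 g2 : 'rV[R]_m -> R) :
  (forall y, sqn y < q -> g1 y = g2 y) -> ballint q g1 = ballint q g2.
Proof.
move=> h; congr int_Rn; apply/funext => y.
by case: ifP => // /h.
Qed.

Lemma cbounded_slice m (q M t : R) (g : 'rV[R]_m.+1 -> R) :
  cbounded q M g -> cbounded (q - t ^+ 2) M (fun y => g (cons_rv t y)).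
Proof.
move=> [gc gM]; split=> y; rewrite ltrBrDl -(sqn_cons_rv t) => hy; last exact: gM.
have hcons : cons_rv t z @[z --> y] --> cons_rv t y.
  by apply: (@cvg_cons_rv _ (nbhs y) _ _ (fun _ => t) id); [exact: cvg_cst | exact: cvg_id].
exact: (@continuous_comp _ _ _ (cons_rv t) g y hcons (gc _ hy)).
Qed.

Section OneDim.
Variables (h : R -> R) (q M K : R).
Hypotheses (K0 : 0 <= K) (M0 : 0 <= M) (qK : q <= K ^+ 2).
Hypothesis hc : forall t : R, t ^+ 2 < q -> {for t, continuous h}.
Hypothesis h0 : forall t : R, q <= t ^+ 2 -> h t = 0.
Hypothesis hM : forall t : R, `|h t| <= M.

Lemma slice_support (t : R) : ~ `[- K, K]%classic t -> h t = 0.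
Proof.
move=> /= /negP; rewrite in_itv /= -ler_norml -ltNge => Kt.
apply: h0; apply: le_trans qK _; rewrite -[leRHS]real_normK ?num_real //.
by rewrite ler_sqr ?nnegrE // ltW.
Qed.

(** [h] may jump where [t ^+ 2 = q]; it is measurable as the extension by zero of a function
    continuous on an open set. *)
Lemma measurable_slice : measurable_fun setT h.
Proof.
pose D := [set t : R | t ^+ 2 < q].
have oD : open D.
  rewrite (_ : D = (fun t : R => t ^+ 2) @^-1` [set x | x < q]) //.
  by apply: open_comp; [move=> t _; exact: exprn_continuous | exact: open_lt].
have mD : measurable D by exact: open_measurable.
have -> : h = h \_ D.
  apply/funext => t; rewrite patchE; case: ifPn => //.
  by rewrite notin_setE /= => /negP; rewrite -leNgt => /h0.
apply/(measurable_restrictT _ mD); apply: open_continuous_measurable_fun => //.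
by move=> t; rewrite inE /= => /hc.
Qed.

Let hE : h = h \_ `[- K, K]%classic.
Proof.
by apply/funext => t; rewrite patchE; case: ifPn => //; rewrite notin_setE => /slice_support.
Qed.

Lemma integrable_slice : mu.-integrable setT (EFin \o h).
Proof.
have ih : mu.-integrable `[- K, K]%classic (EFin \o h).
  apply: measurable_bounded_integrable => //.
  - by rewrite /= lebesgue_measure_itv /=; case: ifP => // _; rewrite ltry.
  - by apply: measurable_funTS; exact: measurable_slice.
  - exists M; split; first exact: num_real.
    by move=> x Mx t _ /=; apply: le_trans (hM t) (ltW Mx).
have := (integrable_mkcond (mu := mu) (EFin \o h) (measurable_itv `[- K, K])).1 ih.
by rewrite restrict_EFin -hE.
Qed.

Lemma Rintegral_slice_bound : `|\int[mu]_t h t| <= M * (2 * K).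
Proof.
rewrite hE -Rintegral_mkcond.
have ih : mu.-integrable `[- K, K]%classic (EFin \o h).
  by apply: integrableS integrable_slice.
apply: le_trans (le_normr_Rintegral _ ih) _ => //.
apply: (le_trans (y := \int[mu]_(t in `[- K, K]%classic) M)).
  apply: le_Rintegral => //; first exact: (integrable_norm ih).
  apply: measurable_bounded_integrable => //.
    by rewrite /= lebesgue_measure_itv /=; case: ifP => // _; rewrite ltry.
  exists M; split; first exact: num_real.
  by move=> x Mx t _ /=; rewrite ger0_norm // ltW.
rewrite Rintegral_cst //= lebesgue_measure_itv /= lte_fin.
case: ifP => _ /=; last by rewrite mulr0 mulr_ge0 // mulr_ge0.
by rewrite opprK mulr2n mulrDl mul1r.
Qed.

End OneDim.

(* Convergence may fail at the two points where [t ^+ 2 = q]. *)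
Lemma cvg_Rintegral_slice (h_ : nat -> R -> R) (h : R -> R) (q_ : nat -> R) (q M K : R) :
  0 <= K -> 0 <= M ->
  (forall k, q_ k <= K ^+ 2) -> q <= K ^+ 2 ->
  (forall k (t : R), t ^+ 2 < q_ k -> {for t, continuous (h_ k)}) ->
  (forall k (t : R), q_ k <= t ^+ 2 -> h_ k t = 0) ->
  (forall k (t : R), `|h_ k t| <= M) ->
  (forall t : R, t ^+ 2 < q -> {for t, continuous h}) ->
  (forall t : R, q <= t ^+ 2 -> h t = 0) ->
  (forall t : R, `|h t| <= M) ->
  (forall t : R, t ^+ 2 != q -> h_ k t @[k --> \oo] --> h t) ->
  \int[mu]_t h_ k t @[k --> \oo] --> \int[mu]_t h t.
Proof.
move=> K0 M0 qkK qK hkc hk0 hkM hc h0 hM hh.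
pose G := EFin \o ((cst M : R -> R) \_ `[- K, K]%classic).
have iG : mu.-integrable setT G.
  have ic : mu.-integrable `[- K, K]%classic (EFin \o (cst M : R -> R)).
    apply: measurable_bounded_integrable => //.
      by rewrite /= lebesgue_measure_itv /=; case: ifP => // _; rewrite ltry.
    exists M; split; first exact: num_real.
    by move=> x Mx t _ /=; rewrite ger0_norm // ltW.
  have := (integrable_mkcond (mu := mu) _ (measurable_itv `[- K, K])).1 ic.
  by rewrite restrict_EFin.
have ih := integrable_slice K0 qK hc h0 hM.
have mk k : measurable_fun setT (EFin \o h_ k).
  by apply/measurable_EFinP; exact: (measurable_slice (hkc k) (hk0 k)).
have mh : measurable_fun setT (EFin \o h).
  by apply/measurable_EFinP; exact: (measurable_slice hc h0).
have ch : {ae mu, forall t, setT t -> (EFin \o h_ k) t @[k --> \oo] --> (EFin \o h) t}.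
  pose N := [set Num.sqrt q; - Num.sqrt q].
  have nN : mu.-negligible N.
    by apply: negligibleU; apply/negligibleP => //; exact: lebesgue_measure_set1.
  apply: negligibleS nN => t /= /not_implyP[_ nt].
  apply: contrapT => Nt; apply: nt.
  apply: cvg_EFin; first exact: nearW.
  apply: hh; apply/eqP => tq; apply: Nt.
  have := sqrtr_sqr t; rewrite tq => e.
  have [t0|t0] := leP 0 t; [left|right]; rewrite /= e.
    by rewrite ger0_norm.
  by rewrite ltr0_norm // opprK.
have bd : {ae mu, forall t, forall k, setT t -> (`|(EFin \o h_ k) t| <= G t)%E}.
  apply: aeW => t k _; rewrite /G /= patchE lee_fin; case: ifPn => [_|]; first exact: hkM.
  by rewrite notin_setE => /(slice_support K0 (qkK k) (hk0 k)) ->; rewrite normr0.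
have [_ _ H] := dominated_convergence (mu := mu) measurableT mk mh ch iG bd.
rewrite /Rintegral; apply: fine_cvg; rewrite fineK //.
exact: integrable_fin_num.
Qed.

(* Both statements are proved together: the bound dominates the slices, and the
   convergence makes them continuous, hence integrable, in the sliced variable. *)
Lemma ballint_bound_cvg m :
  (forall (q M K : R) (g : 'rV[R]_m -> R), 0 <= K -> 0 <= M -> q <= K ^+ 2 ->
     cbounded q M g -> `|ballint q g| <= M * (2 * K) ^+ m) /\
  (forall (q_ : nat -> R) (q M K : R) (g_ : nat -> 'rV[R]_m -> R) (g : 'rV[R]_m -> R),
     0 <= K -> 0 <= M -> 0 < q -> q_ k @[k --> \oo] --> q ->
     (forall k, q_ k <= K ^+ 2) ->
     (forall k, cbounded (q_ k) M (g_ k)) -> cbounded q M g ->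
     (forall y, sqn y < q -> g_ k y @[k --> \oo] --> g y) ->
     ballint (q_ k) (g_ k) @[k --> \oo] --> ballint q g).
Proof.
elim: m => [|m [IHb IHc]].
  have s0 : sqn (0 : 'rV[R]_0) = 0 by rewrite /sqn big_ord0.
  split.
    move=> q M K g K0 M0 qK [_ gM]; rewrite expr0 mulr1 /ballint /= s0.
    by case: ifP => [q0|_]; [apply: gM; rewrite s0 | rewrite normr0].
  move=> q_ q M K g_ g K0 M0 q0 qq _ _ _ gg; rewrite /ballint /= s0 q0.
  have /gg : sqn (0 : 'rV[R]_0) < q by rewrite s0.
  apply: cvg_trans; apply: near_eq_cvg.
  have : \forall k \near \oo, 0 < q_ k by apply: cvgr_gt q0; exact: qq.
  by apply: filterS => k ->.
have slc (q M K : R) (g : 'rV[R]_m.+1 -> R) : 0 <= K -> 0 <= M -> q <= K ^+ 2 ->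
    cbounded q M g ->
    let h t := ballint (q - t ^+ 2) (fun y => g (cons_rv t y)) in
  [/\ (forall t : R, t ^+ 2 < q -> {for t, continuous h}),
      (forall t : R, q <= t ^+ 2 -> h t = 0) &
      (forall t : R, `|h t| <= M * (2 * K) ^+ m)].
  move=> K0 M0 qK Wg h; split=> t.
  (* As [u k] tends to [t], both the radius and the integrand of the slice move; this is why the
     convergence statement lets [q_] and [g_] vary. *)
  - move=> tq; apply/continuous_withinNx; apply/cvgr_dnbhsP => u [_ ut].
    apply: (IHc _ _ M K) => //.
    + by rewrite subr_gt0.
    + apply: cvgB; first exact: cvg_cst.
      exact: (cvgM ut ut).
    + by move=> k; rewrite lerBlDr (le_trans qK) // lerDl sqr_ge0.
    + by move=> k; apply: cbounded_slice.
    + exact: cbounded_slice.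
    + move=> y yq; have /Wg.1 gc : sqn (cons_rv t y) < q.
        by rewrite sqn_cons_rv -ltrBrDl.
      have : cons_rv (u k) y @[k --> \oo] --> cons_rv t y.
        by apply: cvg_cons_rv => //; exact: cvg_cst.
      by move=> /cvg_comp; apply.
  - by move=> qt; rewrite /h ballint_le0 // subr_le0.
  - apply: IHb => //; last exact: cbounded_slice.
    by rewrite lerBlDr (le_trans qK) // lerDl sqr_ge0.
have KM (M K : R) : 0 <= K -> 0 <= M -> 0 <= M * (2 * K) ^+ m.
  by move=> K0 M0; rewrite mulr_ge0 // exprn_ge0 // mulr_ge0.
split.
  move=> q M K g K0 M0 qK Wg; rewrite ballintS exprSr mulrA.
  have [hc h0 hM] := slc _ _ _ _ K0 M0 qK Wg.
  exact: (Rintegral_slice_bound K0 (KM _ _ K0 M0) qK hc h0 hM).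
move=> q_ q M K g_ g K0 M0 q0 qq qkK Wk Wg gg.
have qK : q <= K ^+ 2.
  rewrite leNgt; apply/negP => Kq.
  have /filter_ex[k] : \forall k \near \oo, K ^+ 2 < q_ k.
    by apply: cvgr_gt Kq; exact: qq.
  by rewrite ltNge qkK.
under eq_fun do rewrite ballintS.
rewrite ballintS.
have [hc h0 hM] := slc _ _ _ _ K0 M0 qK Wg.
have sk k := slc _ _ _ _ K0 M0 (qkK k) (Wk k).
apply: (cvg_Rintegral_slice K0 (KM _ _ K0 M0) qkK qK _ _ _ hc h0 hM) => [k|k|k|].
- by have [] := sk k.
- by have [] := sk k.
- by have [] := sk k.
(* Inside, the induction hypothesis applies; outside, the slices are eventually empty balls. The
   case [t ^+ 2 = q] is a null set. *)
move=> t; rewrite neq_lt => /orP[tq|qt].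
  apply: (IHc _ _ M K) => //.
  + by rewrite subr_gt0.
  + by apply: cvgB => //; exact: cvg_cst.
  + by move=> k; rewrite lerBlDr (le_trans (qkK k)) // lerDl sqr_ge0.
  + by move=> k; apply: cbounded_slice.
  + exact: cbounded_slice.
  + by move=> y yq; apply: gg; rewrite sqn_cons_rv -ltrBrDl.
rewrite h0 ?ltW //.
have : \forall k \near \oo, q_ k < t ^+ 2 by apply: cvgr_lt qt; exact: qq.
move=> near; apply: cvg_near_cst; apply: filterS near => k qkt.
by have [_ -> //] := sk k; apply: ltW.
Qed.

End SlicedBallIntegral.

(** * Volume, first and second moments of the ball *)

Section BallMoments.
Variable R : realType.
Local Notation mu := (@lebesgue_measure R).

Definition cbd m (q : R) (g : 'rV[R]_m -> R) : Prop :=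
  exists2 M : R, 0 <= M & cbounded q M g.

Lemma cbd_slice m (q t : R) (g : 'rV[R]_m.+1 -> R) :
  cbd q g -> cbd (q - t ^+ 2) (fun y => g (cons_rv t y)).
Proof. by move=> [M M0 h]; exists M => //; apply: cbounded_slice. Qed.

Lemma cbdD m (q : R) (g1 g2 : 'rV[R]_m -> R) :
  cbd q g1 -> cbd q g2 -> cbd q (fun y => g1 y + g2 y).
Proof.
move=> [M1 M10 [c1 b1]] [M2 M20 [c2 b2]]; exists (M1 + M2); first exact: addr_ge0.
split=> y yq; first exact: (cvgD (c1 y yq) (c2 y yq)).
by apply: le_trans (ler_normD _ _) _; apply: lerD; [exact: b1 | exact: b2].
Qed.

Lemma cbdM m (q : R) (g1 g2 : 'rV[R]_m -> R) :
  cbd q g1 -> cbd q g2 -> cbd q (fun y => g1 y * g2 y).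
Proof.
move=> [M1 M10 [c1 b1]] [M2 M20 [c2 b2]]; exists (M1 * M2); first exact: mulr_ge0.
split=> y yq; first exact: (cvgM (c1 y yq) (c2 y yq)).
by rewrite normrM; apply: ler_pM => //; [exact: b1 | exact: b2].
Qed.

Lemma cbd_cst m (q a : R) : cbd q (fun _ : 'rV[R]_m => a).
Proof. by exists `|a|; [exact: normr_ge0 | split=> y _; [exact: cst_continuous | exact: lexx]]. Qed.

Lemma cbd_coord m (q : R) i : cbd q (fun y : 'rV[R]_m => y 0 i).
Proof.
exists (Num.sqrt `|q|); first exact: sqrtr_ge0.
split=> y yq; first exact: coord_continuous.
rewrite -sqrtr_sqr ler_wsqrtr //; apply: le_trans (ler_norm _).
apply: le_trans (ltW yq); rewrite /sqn (bigD1 i) //= lerDl.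
by apply: sumr_ge0 => j _; apply: sqr_ge0.
Qed.

Lemma cbd_sum m (q : R) (I : finType) (g : I -> 'rV[R]_m -> R) :
  (forall i, cbd q (g i)) -> cbd q (fun y => \sum_i g i y).
Proof.
move=> h; elim: (index_enum I) => [|i s IH].
  by under eq_fun do rewrite big_nil; apply: cbd_cst.
by under eq_fun do rewrite big_cons; apply: cbdD.
Qed.

Lemma slice_radius (q : R) : exists2 K : R, 0 <= K & q <= K ^+ 2.
Proof.
exists (1 + `|q|); first by rewrite addr_ge0.
by have := ler_norm q; have := normr_ge0 q; nra.
Qed.

Lemma integrable_ballint_slice m (q : R) (g : 'rV[R]_m.+1 -> R) : cbd q g ->
  mu.-integrable setT
    (EFin \o (fun t : R => ballint (q - t ^+ 2) (fun y => g (cons_rv t y)))).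
Proof.
move=> [M M0 Wg]; have [K K0 qK] := slice_radius q.
have [hb hc] := ballint_bound_cvg R m.
apply: (@integrable_slice _ _ q (M * (2 * K) ^+ m) K) => // t.
- move=> tq; apply/continuous_withinNx; apply/cvgr_dnbhsP => u [_ ut].
  apply: (hc _ _ M K) => //.
  + by rewrite subr_gt0.
  + by apply: cvgB; [exact: cvg_cst | exact: (cvgM ut ut)].
  + by move=> k; rewrite lerBlDr (le_trans qK) // lerDl sqr_ge0.
  + by move=> k; apply: cbounded_slice.
  + exact: cbounded_slice.
  + move=> y yq; have /Wg.1 gc : sqn (cons_rv t y) < q.
      by rewrite sqn_cons_rv -ltrBrDl.
    have : cons_rv (u k) y @[k --> \oo] --> cons_rv t y.
      by apply: cvg_cons_rv => //; exact: cvg_cst.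
    by move=> /cvg_comp; apply.
- by move=> qt; rewrite ballint_le0 // subr_le0.
- apply: hb => //; last exact: cbounded_slice.
  by rewrite lerBlDr (le_trans qK) // lerDl sqr_ge0.
Qed.

Lemma ballintD m (q : R) (g1 g2 : 'rV[R]_m -> R) : cbd q g1 -> cbd q g2 ->
  ballint q (fun y => g1 y + g2 y) = ballint q g1 + ballint q g2.
Proof.
elim: m => [|m IH] in q g1 g2 *.
  by move=> _ _; rewrite /ballint /=; case: ifP => _ //; rewrite addr0.
move=> W1 W2; rewrite !ballintS -RintegralD //; try exact: integrable_ballint_slice.
by apply: eq_Rintegral => t _; apply: IH; apply: cbd_slice.
Qed.

Lemma ballintZ m (q a : R) (g : 'rV[R]_m -> R) : cbd q g ->
  ballint q (fun y => a * g y) = a * ballint q g.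
Proof.
elim: m => [|m IH] in q g *.
  by move=> _; rewrite /ballint /=; case: ifP => _ //; rewrite mulr0.
move=> W; rewrite !ballintS -RintegralZl //; last exact: integrable_ballint_slice.
by apply: eq_Rintegral => t _; apply: IH; apply: cbd_slice.
Qed.

Lemma ballint_sum m (q : R) (I : finType) (g : I -> 'rV[R]_m -> R) :
  (forall i, cbd q (g i)) ->
  ballint q (fun y => \sum_i g i y) = \sum_i ballint q (g i).
Proof.
move=> h; elim: (index_enum I) => [|i s IH].
  rewrite big_nil -[RHS](int_Rn0 R m); congr int_Rn; apply/funext => y.
  by rewrite big_nil if_same.
rewrite big_cons -IH -ballintD //.
  by apply: eq_ballint => y _; rewrite big_cons.
elim: s {IH} => [|j s IH].
  by under eq_fun do rewrite big_nil; apply: cbd_cst.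
by under eq_fun do rewrite big_cons; apply: cbdD.
Qed.

Lemma le_ballint m (q : R) (g1 g2 : 'rV[R]_m -> R) : cbd q g1 -> cbd q g2 ->
  (forall y, sqn y < q -> g1 y <= g2 y) -> ballint q g1 <= ballint q g2.
Proof.
elim: m => [|m IH] in q g1 g2 *.
  by move=> _ _ le; rewrite /ballint /=; case: ifP => // /le.
move=> W1 W2 le; rewrite !ballintS; apply: le_Rintegral => //;
  try exact: integrable_ballint_slice.
move=> t _; apply: IH; try exact: cbd_slice.
by move=> y; rewrite ltrBrDl -(sqn_cons_rv t) => /le.
Qed.

Lemma Rintegral_FTC2 (F f : R -> R) (a b : R) : a < b ->
  continuous f -> continuous F ->
  (forall t, a < t < b -> is_derive t 1 F (f t)) ->
  \int[mu]_(t in `[a, b]%classic) f t = F b - F a.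
Proof.
move=> ab fc Fc dF; rewrite /Rintegral (@continuous_FTC2 _ f F) //.
- exact: continuous_subspaceT.
- split.
  + by move=> t; rewrite in_itv /= => /dF[].
  + by apply: cvg_at_right_filter; exact: Fc.
  + by apply: cvg_at_left_filter; exact: Fc.
- move=> t; rewrite in_itv /= => /dF h; rewrite derive1E.
  by case: h.
Qed.

Lemma sqrt_slice_continuous (q : R) m : continuous (fun t : R => Num.sqrt (q - t ^+ 2) ^+ m).
Proof.
move=> t; apply: (@continuous_comp _ _ _ (fun t : R => Num.sqrt (q - t ^+ 2)) (fun x => x ^+ m)).
  apply: (@continuous_comp _ _ _ (fun t : R => q - t ^+ 2) Num.sqrt).
    by apply: cvgB; [exact: cvg_cst | exact: exprn_continuous].
  exact: sqrt_continuous.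
exact: exprn_continuous.
Qed.

(* [h] and [p] may differ at the endpoints [- Num.sqrt q] and [Num.sqrt q]. *)
Lemma Rintegral_slice_itv (q : R) (p h : R -> R) : 0 < q -> continuous p ->
  (forall t, t ^+ 2 < q -> h t = p t) -> (forall t, q <= t ^+ 2 -> h t = 0) ->
  \int[mu]_t h t = \int[mu]_(t in `[- Num.sqrt q, Num.sqrt q]%classic) p t.
Proof.
move=> q0 pc hp h0; set r := Num.sqrt q.
have rq : r ^+ 2 = q by rewrite sqr_sqrtr // ltW.
have r0 : 0 < r by rewrite sqrtr_gt0.
have lt t : (t ^+ 2 < q) = (- r < t < r).
  by rewrite -ltr_norml -rq -[t ^+ 2]real_normK ?num_real // ltr_sqr ?nnegrE // ltW.
have ip : mu.-integrable `[- r, r]%classic (EFin \o p).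
  apply: continuous_compact_integrable; first exact: segment_compact.
  exact: continuous_subspaceT.
rewrite -Rintegral_itv_obnd_cbnd; last first.
  by apply: integrableS ip => //; apply: subset_itv; rewrite bnd_simp.
rewrite -Rintegral_itv_bndo_bndc; last first.
  by apply: integrableS ip => //; apply: subset_itv; rewrite bnd_simp.
rewrite [RHS]Rintegral_mkcond; apply: eq_Rintegral => t _; rewrite patchE.
case: ifPn; first by rewrite inE /= in_itv /= -lt => /hp.
by rewrite notin_setE /= in_itv /= -lt => /negP; rewrite -leNgt => /h0.
Qed.

Lemma is_derive_sqrt_slice (q t : R) m : t ^+ 2 < q ->
  is_derive t 1 (fun t : R => Num.sqrt (q - t ^+ 2) ^+ m.+2)
    (- m.+2%:R * t * Num.sqrt (q - t ^+ 2) ^+ m).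
Proof.
move=> tq; have w0 : 0 < q - t ^+ 2 by rewrite subr_gt0.
have d1 : is_derive t 1 (fun t : R => q - t ^+ 2) (- (2 * t)).
  by apply: is_derive_eq; rewrite /GRing.scale /=; ring.
have d2 := @is_derive1_comp _ _ (fun t : R => q - t ^+ 2) t _ _ (is_derive1_sqrt w0) d1.
have d3 := is_deriveX m.+2 d2; rewrite exprfctE in d3.
apply: (is_derive_eq d3).
have s0 : Num.sqrt (q - t ^+ 2) != 0 by rewrite gt_eqF // sqrtr_gt0.
rewrite /= exprS /GRing.scale /=; field.
by rewrite s0.
Qed.

Lemma lt_sqrt_sqr (q t : R) : 0 < q -> - Num.sqrt q < t < Num.sqrt q -> t ^+ 2 < q.
Proof.
move=> q0; rewrite -ltr_norml => h.
rewrite -[ltRHS]sqr_sqrtr ?(ltW q0) // -[t ^+ 2]real_normK ?num_real //.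
by rewrite ltr_sqr ?nnegrE ?sqrtr_ge0.
Qed.

Lemma sqrt_slice_moment1 (q : R) m : 0 < q ->
  \int[mu]_(t in `[- Num.sqrt q, Num.sqrt q]%classic) (t * Num.sqrt (q - t ^+ 2) ^+ m) = 0.
Proof.
move=> q0; set r := Num.sqrt q.
have rq : r ^+ 2 = q by rewrite sqr_sqrtr // ltW.
have r0 : 0 < r by rewrite sqrtr_gt0.
(* An even primitive of the odd integrand, so the endpoint values cancel. *)
pose F (t : R) := - m.+2%:R^-1 * Num.sqrt (q - t ^+ 2) ^+ m.+2.
transitivity (F r - F (- r)); last by rewrite /F sqrrN rq subrr.
apply: Rintegral_FTC2.
- by rewrite gtrN.
- by move=> t; apply: cvgM; [exact: cvg_id | exact: sqrt_slice_continuous].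
- by move=> t; apply: cvgM; [exact: cvg_cst | exact: sqrt_slice_continuous].
move=> t /(lt_sqrt_sqr q0) tq.
apply: is_derive_eq (is_deriveZ (- m.+2%:R^-1) (is_derive_sqrt_slice m tq)) _.
rewrite /GRing.scale /=; field.
by rewrite -natr1 -natr1 -addrA gt_eqF // ltr_wpDl.
Qed.

(** With [w = Num.sqrt (q - t ^+ 2)], the integrand is the derivative of [t * w ^+ m.+2], which
    vanishes at both ends. This relates the second moment to the volume without computing either;
    [m.+3] is the dimension [m.+1] plus 2. *)
Lemma sqrt_slice_moment2 (q : R) m : 0 < q ->
  \int[mu]_(t in `[- Num.sqrt q, Num.sqrt q]%classic)
     ((q - m.+3%:R * t ^+ 2) * Num.sqrt (q - t ^+ 2) ^+ m) = 0.
Proof.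
move=> q0; set r := Num.sqrt q.
have rq : r ^+ 2 = q by rewrite sqr_sqrtr // ltW.
have r0 : 0 < r by rewrite sqrtr_gt0.
pose F (t : R) := t * Num.sqrt (q - t ^+ 2) ^+ m.+2.
transitivity (F r - F (- r)); last first.
  by rewrite /F sqrrN rq subrr sqrtr0 expr0n /= !mulr0 subrr.
apply: Rintegral_FTC2.
- by rewrite gtrN.
- move=> t; apply: cvgM; last exact: sqrt_slice_continuous.
  apply: cvgB; first exact: cvg_cst.
  by apply: cvgM; [exact: cvg_cst | exact: exprn_continuous].
- by move=> t; apply: cvgM; [exact: cvg_id | exact: sqrt_slice_continuous].
move=> t /(lt_sqrt_sqr q0) tq.
apply: is_derive_eq (is_deriveM (is_derive_id t 1) (is_derive_sqrt_slice m tq)) _.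
rewrite /GRing.scale /= mulr1.
have w2 : Num.sqrt (q - t ^+ 2) * Num.sqrt (q - t ^+ 2) = q - t ^+ 2.
  by rewrite -expr2 sqr_sqrtr // subr_ge0 ltW.
move: w2; set w := Num.sqrt _ => w2.
by rewrite (exprS w) (exprS w) [w * (w * _)]mulrA w2 -!natr1; ring.
Qed.

Lemma sqrt_slice_gt0 m :
  0 < \int[mu]_(t in `[- 1, 1 : R]%classic) Num.sqrt (1 - t ^+ 2) ^+ m.
Proof.
have ip : mu.-integrable `[- 1, 1]%classic (EFin \o (fun t => Num.sqrt (1 - t ^+ 2) ^+ m)).
  apply: continuous_compact_integrable; first exact: segment_compact.
  by apply: continuous_subspaceT; exact: sqrt_slice_continuous.
(* On the middle half of the interval, [Num.sqrt (1 - t ^+ 2)] is at least one half. *)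
apply: (lt_le_trans (y := \int[mu]_(t in `[- 2^-1, 2^-1 : R]%classic) (2^-1 ^+ m))).
  rewrite Rintegral_cst //= lebesgue_measure_itv /= lte_fin ifT /=; last by lra.
  by rewrite mulr_gt0 // ?exprn_gt0 //; lra.
rewrite Rintegral_mkcond [leRHS]Rintegral_mkcond; apply: le_Rintegral => //.
- have ic : mu.-integrable `[- 2^-1, 2^-1]%classic (EFin \o (cst (2^-1 ^+ m) : R -> R)).
    apply: continuous_compact_integrable; first exact: segment_compact.
    by apply: continuous_subspaceT; exact: cst_continuous.
  have := (integrable_mkcond (mu := mu) _ (measurable_itv `[- 2^-1, 2^-1])).1 ic.
  by rewrite restrict_EFin.
- have := (integrable_mkcond (mu := mu) _ (measurable_itv `[- 1, 1])).1 ip.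
  by rewrite restrict_EFin.
move=> t _; rewrite !patchE; case: ifPn => [|_]; last first.
  by case: ifP => // _; rewrite exprn_ge0 // sqrtr_ge0.
rewrite inE /= in_itv /= => /andP[t1 t2].
rewrite ifT; last by rewrite inE /= in_itv /=; apply/andP; split; lra.
apply: lerXn2r; rewrite ?nnegrE ?sqrtr_ge0 //.
rewrite -[leLHS]ger0_norm ?invr_ge0 // -sqrtr_sqr ler_wsqrtr //.
by nra.
Qed.


Lemma sqrt_slice_scale (q : R) m : 0 < q ->
  \int[mu]_(t in `[- Num.sqrt q, Num.sqrt q]%classic) Num.sqrt (q - t ^+ 2) ^+ m =
  Num.sqrt q ^+ m.+1 *
    \int[mu]_(t in `[- 1, 1 : R]%classic) Num.sqrt (1 - t ^+ 2) ^+ m.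
Proof.
move=> q0; set r := Num.sqrt q.
have rq : r ^+ 2 = q by rewrite sqr_sqrtr // ltW.
have r0 : 0 < r by rewrite sqrtr_gt0.
have ip : mu.-integrable `[- 1, 1]%classic (EFin \o (fun t => Num.sqrt (1 - t ^+ 2) ^+ m)).
  apply: continuous_compact_integrable; first exact: segment_compact.
  by apply: continuous_subspaceT; exact: sqrt_slice_continuous.
rewrite -RintegralZl //.
pose F : R -> R := (fun t : R => r * t).
have dF : derive1 F = cst r.
  apply/funext => t; rewrite derive1E /F.
  have [] : is_derive t 1 (fun t : R => r * t) r; last by [].
  by apply: is_derive_eq; rewrite /GRing.scale /=; ring.
rewrite /Rintegral; congr fine.
rewrite -[- r]mulrN1 -[X in `[_, X]]mulr1.
rewrite (@integration_by_substitution_increasing _ F) /=.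
- apply: eq_integral => t; rewrite inE /= in_itv /= => /andP[t1 t2].
  rewrite dF; congr EFin.
  transitivity (Num.sqrt (q - (r * t) ^+ 2) ^+ m * r) => //.
  have -> : q - (r * t) ^+ 2 = q * (1 - t ^+ 2) by rewrite exprMn rq; ring.
  rewrite sqrtrM ?(ltW q0) // -/r exprMn (exprSr r); ring.
- by lra.
- by move=> x y _ _; rewrite ltr_pM2l.
- by rewrite dF => t _; exact: cst_continuous.
- by rewrite dF; exact: is_cvg_cst.
- by rewrite dF; exact: is_cvg_cst.
- split.
  + by move=> t _; apply: ex_derive.
  + by apply: cvg_at_right_filter; apply: cvgM; [exact: cvg_cst | exact: cvg_id].
  + by apply: cvg_at_left_filter; apply: cvgM; [exact: cvg_cst | exact: cvg_id].
- by apply: continuous_subspaceT; exact: sqrt_slice_continuous.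
Qed.

(** Only the homogeneity in the radius matters: averages are ratios to the volume, so [c] stays
    unspecified. *)
Lemma ball_volume m : exists2 c : R, 0 < c &
  forall q, 0 < q -> ballint q (fun _ : 'rV[R]_m => 1) = c * Num.sqrt q ^+ m.
Proof.
elim: m => [|m [c c0 IH]].
  exists 1 => // q q0; rewrite /ballint /= expr0 mulr1 ifT //.
  by rewrite /sqn big_ord0.
exists (c * \int[mu]_(t in `[- 1, 1 : R]%classic) Num.sqrt (1 - t ^+ 2) ^+ m).
  by rewrite mulr_gt0 // sqrt_slice_gt0.
move=> q q0; rewrite ballintS.
rewrite (@Rintegral_slice_itv q (fun t => c * Num.sqrt (q - t ^+ 2) ^+ m)) //.
- rewrite RintegralZl // ?sqrt_slice_scale //; first by rewrite mulrAC mulrA.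
  apply: continuous_compact_integrable; first exact: segment_compact.
  by apply: continuous_subspaceT; exact: sqrt_slice_continuous.
- by move=> t; apply: cvgM; [exact: cvg_cst | exact: sqrt_slice_continuous].
- by move=> t tq; apply: IH; rewrite subr_gt0.
- by move=> t tq; rewrite ballint_le0 // subr_le0.
Qed.

Lemma ball_volume_gt0 m (q : R) : 0 < q -> 0 < ballint q (fun _ : 'rV[R]_m => 1).
Proof.
move=> q0; have [c c0 ->//] := ball_volume m.
by rewrite mulr_gt0 // exprn_gt0 // sqrtr_gt0.
Qed.

Lemma ballint_coord0 m (q : R) (p : R -> R) :
  ballint q (fun y : 'rV[R]_m.+1 => p (y 0 ord0)) =
  \int[mu]_t (p t * ballint (q - t ^+ 2) (fun _ : 'rV[R]_m => 1)).
Proof.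
rewrite ballintS; apply: eq_Rintegral => t _.
rewrite -ballintZ; last exact: cbd_cst.
by apply: eq_ballint => y _; rewrite cons_rv0 mulr1.
Qed.

Lemma ball_moment1_coord0 m (q : R) : 0 < q ->
  ballint q (fun y : 'rV[R]_m.+1 => y 0 ord0) = 0.
Proof.
move=> q0; have [c c0 cE] := ball_volume m.
rewrite (ballint_coord0 m q id).
pose p (t : R) := c * (t * Num.sqrt (q - t ^+ 2) ^+ m).
have pc : continuous (fun t : R => t * Num.sqrt (q - t ^+ 2) ^+ m).
  by move=> t; apply: cvgM; [exact: cvg_id | exact: sqrt_slice_continuous].
rewrite (@Rintegral_slice_itv q p) //.
- rewrite RintegralZl // ?sqrt_slice_moment1 ?mulr0 //.
  apply: continuous_compact_integrable; first exact: segment_compact.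
  exact: continuous_subspaceT.
- by move=> t; apply: cvgM; [exact: cvg_cst | exact: pc].
- by move=> t tq; rewrite cE ?subr_gt0 // /p /=; ring.
- by move=> t tq; rewrite ballint_le0 ?mulr0 // subr_le0.
Qed.

Lemma ball_moment2_coord0 m (q : R) : 0 < q ->
  ballint q (fun y : 'rV[R]_m.+1 => y 0 ord0 ^+ 2) =
  q / m.+3%:R * ballint q (fun _ : 'rV[R]_m.+1 => 1).
Proof.
move=> q0; have [c c0 cE] := ball_volume m.
pose p (t : R) := c * ((q - m.+3%:R * t ^+ 2) * Num.sqrt (q - t ^+ 2) ^+ m).
have pc : continuous (fun t : R => (q - m.+3%:R * t ^+ 2) * Num.sqrt (q - t ^+ 2) ^+ m).
  move=> t; apply: cvgM; last exact: sqrt_slice_continuous.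
  apply: cvgB; first exact: cvg_cst.
  by apply: cvgM; [exact: cvg_cst | exact: exprn_continuous].
have c2 : cbd q (fun y : 'rV[R]_m.+1 => y 0 ord0 ^+ 2) by apply: cbdM; apply: cbd_coord.
(* The slices have volume [c * Num.sqrt (q - t ^+ 2) ^+ m], so this is [c] times the vanishing
   integral of [sqrt_slice_moment2]. *)
have : ballint q (fun y : 'rV[R]_m.+1 => q * 1 + - m.+3%:R * y 0 ord0 ^+ 2) = 0.
  rewrite (ballint_coord0 m q (fun t => q * 1 + - m.+3%:R * t ^+ 2)).
  rewrite (@Rintegral_slice_itv q p) //.
  - rewrite RintegralZl // ?sqrt_slice_moment2 ?mulr0 //.
    apply: continuous_compact_integrable; first exact: segment_compact.
    exact: continuous_subspaceT.
  - by move=> t; apply: cvgM; [exact: cvg_cst | exact: pc].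
  - by move=> t tq; rewrite cE ?subr_gt0 // /p; ring.
  - by move=> t tq; rewrite ballint_le0 ?mulr0 // subr_le0.
rewrite ballintD; [|by apply: cbdM; apply: cbd_cst|by apply: cbdM => //; apply: cbd_cst].
rewrite !ballintZ //; last exact: cbd_cst.
move=> h; have m3 : (m.+3%:R : R) != 0 by rewrite pnatr_eq0.
apply: (mulfI m3); move: h; set X := ballint q _; set Y := ballint q _ => h.
have -> : m.+3%:R * (q / m.+3%:R * X) = q * X by field; move: m3; rewrite -!natr1 -!addrA.
by lra.
Qed.

Lemma ball_moment1 m (q : R) i : ballint q (fun y : 'rV[R]_m => y 0 i) = 0.
Proof.
elim: m => [|m IH] in q i *; first by case: i.
have [q0|q0] := leP q 0; first exact: ballint_le0.
case: (unliftP ord0 i) => [j|] -> ; last exact: ball_moment1_coord0.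
rewrite ballintS -[RHS](mul0r (fine (mu setT))) -Rintegral_cst //.
apply: eq_Rintegral => t _; rewrite -[RHS](IH (q - t ^+ 2) j).
by apply: eq_ballint => y _; rewrite cons_rvS.
Qed.

Lemma ball_moment2 m (q : R) i j :
  ballint q (fun y : 'rV[R]_m => y 0 i * y 0 j) =
  (i == j)%:R * (q / m.+2%:R) * ballint q (fun _ : 'rV[R]_m => 1).
Proof.
elim: m => [|m IH] in q i j *; first by case: i.
have [q0|q0] := leP q 0; first by rewrite !ballint_le0 // mulr0.
have c2 : cbd q (fun y : 'rV[R]_m.+1 => y 0 ord0 ^+ 2) by apply: cbdM; apply: cbd_coord.
have cross (k : 'I_m) : ballint q (fun y : 'rV[R]_m.+1 => y 0 ord0 * y 0 (lift ord0 k)) = 0.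
  rewrite ballintS -[RHS](mul0r (fine (mu setT))) -Rintegral_cst //.
  apply: eq_Rintegral => t _; rewrite -(mulr0 t) -[in RHS](ball_moment1 (q - t ^+ 2) k).
  rewrite -ballintZ; last exact: cbd_coord.
  by apply: eq_ballint => y _; rewrite cons_rvS cons_rv0.
case: (unliftP ord0 i) => [i'|] ->; case: (unliftP ord0 j) => [j'|] ->.
- rewrite ballintS (inj_eq lift_inj).
  (* A slice has squared radius [q - t ^+ 2] and dimension [m], giving the factor
     [(q - t ^+ 2) / (m + 2)]. Averaging [t ^+ 2] to [q / (m + 3)] turns this into [q / (m + 3)]. *)
  transitivity (ballint q (fun y : 'rV[R]_m.+1 =>
      (i' == j')%:R * ((q - y 0 ord0 ^+ 2) / m.+2%:R))).
    rewrite (ballint_coord0 m q (fun t => (i' == j')%:R * ((q - t ^+ 2) / m.+2%:R))).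
    apply: eq_Rintegral => t _; rewrite -IH.
    by apply: eq_ballint => y _; rewrite !cons_rvS.
  transitivity (ballint q (fun y : 'rV[R]_m.+1 =>
      (i' == j')%:R * q / m.+2%:R * 1 + - ((i' == j')%:R / m.+2%:R) * y 0 ord0 ^+ 2)).
    by apply: eq_ballint => y _; ring.
  rewrite ballintD; [|by apply: cbdM; apply: cbd_cst|by apply: cbdM => //; apply: cbd_cst].
  rewrite !ballintZ //; last exact: cbd_cst.
  rewrite ball_moment2_coord0 //; field.
  by rewrite -!natr1; apply/andP; split; rewrite gt_eqF // ?ltr_wpDl // !ltr_wpDl.
- rewrite eq_sym (negbTE (neq_lift _ _)) !mul0r -[RHS](cross i').
  by apply: eq_ballint => y _; rewrite mulrC.
- by rewrite (negbTE (neq_lift _ _)) !mul0r cross.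
- by rewrite eqxx mul1r -ball_moment2_coord0.
Qed.

Lemma ball_avgE m (eps : R) (g : 'rV[R]_m -> R) : 0 < eps ->
  ball_avg eps g = ballint (eps ^+ 2) g / ballint (eps ^+ 2) (fun _ : 'rV[R]_m => 1).
Proof.
move=> e0.
have lt (y : 'rV[R]_m) : (eucl_norm y < eps) = (sqn y < eps ^+ 2).
  rewrite /eucl_norm -/(sqn y) -[in RHS](sqr_sqrtr (sqn_ge0 y)).
  by rewrite ltr_sqr ?nnegrE ?sqrtr_ge0 // ltW.
rewrite /ball_avg; congr (_ / _); congr int_Rn; apply/funext => y; by rewrite lt.
Qed.

Lemma ballint_quadratic m (q a : R) (b : 'I_m -> R) (K : 'M[R]_m) :
  ballint q (fun y => a + \sum_i b i * y 0 i + 2^-1 * bform K y y) =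
  (a + q / (2 * m.+2%:R) * \tr K) * ballint q (fun _ : 'rV[R]_m => 1).
Proof.
have cb : cbd q (fun y : 'rV[R]_m => \sum_i b i * y 0 i).
  by apply: cbd_sum => i; apply: cbdM; [exact: cbd_cst | exact: cbd_coord].
have cK : cbd q (fun y : 'rV[R]_m => bform K y y).
  under eq_fun do rewrite bformE.
  apply: cbd_sum => i; apply: cbd_sum => j; apply: cbdM; last exact: cbd_coord.
  by apply: cbdM; [exact: cbd_coord | exact: cbd_cst].
rewrite ballintD; first last.
- by apply: cbdM => //; exact: cbd_cst.
- by apply: cbdD => //; exact: cbd_cst.
rewrite ballintD //; last exact: cbd_cst.
rewrite ballintZ // ballint_sum => [|i]; last by apply: cbdM; [exact: cbd_cst | exact: cbd_coord].
rewrite [X in _ + X + _]big1 => [|i _]; last first.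
  by rewrite ballintZ ?ball_moment1 ?mulr0 //; exact: cbd_coord.
have -> : ballint q (fun _ : 'rV[R]_m => a) = a * ballint q (fun _ : 'rV[R]_m => 1).
  rewrite -ballintZ; last exact: cbd_cst.
  by apply: eq_ballint => y _; rewrite mulr1.
have -> : ballint q (fun y => bform K y y) =
    q / m.+2%:R * \tr K * ballint q (fun _ : 'rV[R]_m => 1).
  transitivity (ballint q (fun y : 'rV[R]_m => \sum_i \sum_j K i j * (y 0 i * y 0 j))).
    apply: eq_ballint => y _; rewrite bformE; apply: eq_bigr => i _.
    by apply: eq_bigr => j _; ring.
  have cij i j : cbd q (fun y : 'rV[R]_m => K i j * (y 0 i * y 0 j)).
    by apply: cbdM; [exact: cbd_cst | apply: cbdM; exact: cbd_coord].
  rewrite ballint_sum => [|i]; last exact: cbd_sum.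
  rewrite /mxtrace mulr_sumr mulr_suml; apply: eq_bigr => i _.
  rewrite ballint_sum // (bigD1 i) //= big1 => [|j ji].
    rewrite addr0 ballintZ; last by apply: cbdM; exact: cbd_coord.
    by rewrite ball_moment2 eqxx mul1r; ring.
  rewrite ballintZ; last by apply: cbdM; exact: cbd_coord.
  by rewrite ball_moment2 eq_sym (negbTE ji) !mul0r mulr0.
by rewrite addr0 invfM; ring.
Qed.

End BallMoments.

(** * Directional derivatives and one-sided Taylor estimates *)

Section SecondOrderCalculus.
Variable R : realType.

Lemma rV_coord_le n (z : 'rV[R]_n) i : `|z 0 i| <= `|z|.
Proof.
have /mapP[j Hj ->] : `|z ord0 i| \in [seq `|z x.1 x.2| | x : 'I_1 * 'I_n].
  by apply/mapP; exists (ord0, i) => //=; rewrite mem_enum.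
by rewrite [leRHS]/Num.norm /= mx_normrE; apply/bigmax_geP; right => /=; exists j.
Qed.

Lemma rV_norm_le n (z : 'rV[R]_n) (c : R) : 0 <= c -> (forall i, `|z 0 i| <= c) -> `|z| <= c.
Proof.
move=> c0 h; rewrite [leLHS]/Num.norm /= mx_normrE; apply/bigmax_leP; split=> // -[i j] _ /=.
by rewrite ord1.
Qed.

Lemma norm_evec n (i : 'I_n) : `|@evec R n i| <= 1.
Proof.
apply: rV_norm_le => // j; rewrite mxE; case: (_ && _); first by rewrite normr1.
by rewrite normr0.
Qed.

Lemma rV_sum_evec n (z : 'rV[R]_n) : z = \sum_i z 0 i *: @evec R n i.
Proof. exact: row_sum_delta. Qed.

Lemma sqr_norm_le_sqn n (z : 'rV[R]_n) : `|z| ^+ 2 <= sqn z.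
Proof.
have s0 := sqn_ge0 z.
rewrite -[leRHS]sqr_sqrtr // ler_sqr ?nnegrE ?sqrtr_ge0 //.
apply: rV_norm_le; first exact: sqrtr_ge0.
move=> i; rewrite -sqrtr_sqr ler_wsqrtr // /sqn (bigD1 i) //= lerDl.
by apply: sumr_ge0 => j _; apply: sqr_ge0.
Qed.

(** The increment form has no quotient and also covers [h = 0], so derivatives are transported along
    lines, translations and dilations by inequalities alone. *)
Lemma is_derive_intro (V : normedModType R) (G : V -> R) p v d :
  (forall eta : R, 0 < eta -> exists2 rho : R, 0 < rho & forall h, `|h| < rho ->
     `|G (h *: v + p) - G p - h * d| <= eta * `|h|) ->
  is_derive p v G d.
Proof.
move=> hG.
have C : (fun h => h^-1 *: ((G \o shift p) (h *: v) - G p)) @ 0^' --> d.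
  apply/cvgrPdist_le => eta eta0; have [rho rho0 hr] := hG _ eta0.
  near=> h.
  have h0 : h != 0 by near: h; exact: nbhs_dnbhs_neq.
  have hrho : `|h| < rho.
    by near: h; apply: dnbhs0_lt.
  have hn : 0 < `|h| by rewrite normr_gt0.
  rewrite -(ler_pM2r hn) -normrM; apply: le_trans (hr _ hrho).
  rewrite le_eqVlt distrC /GRing.scale /=; apply/orP; left; apply/eqP; congr `|_|.
  by field.
by apply: DeriveDef; [apply/cvg_ex; exists d | apply: cvg_lim].
Unshelve. all: by end_near. Qed.

Lemma is_derive_elim (V : normedModType R) (G : V -> R) p v d : is_derive p v G d ->
  forall eta : R, 0 < eta -> exists2 rho : R, 0 < rho & forall h, `|h| < rho ->
     `|G (h *: v + p) - G p - h * d| <= eta * `|h|.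
Proof.
move=> [exd vd] eta eta0.
have C : (fun h => h^-1 *: ((G \o shift p) (h *: v) - G p)) @ 0^' --> d.
  by rewrite -vd; exact: exd.
move/cvgrPdist_le: C => /(_ _ eta0)[rho /= rho0 hr].
exists rho => // h hrho.
have [->|h0] := eqVneq h 0.
  by rewrite scale0r add0r subrr mul0r subrr normr0 mulr0.
have := hr h; rewrite /= sub0r normrN => /(_ hrho h0).
have hn : 0 < `|h| by rewrite normr_gt0.
rewrite -(ler_pM2r hn) -normrM; apply: le_trans.
rewrite le_eqVlt distrC /GRing.scale /=; apply/orP; left; apply/eqP; congr `|_|.
by field.
Qed.

Lemma is_derive_path (V : normedModType R) (G : V -> R) (x z : V) (a d : R) :
  is_derive (a *: z + x) z G d -> is_derive a 1 (fun a : R => G (a *: z + x)) d.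
Proof.
move=> /is_derive_elim h; apply: is_derive_intro => eta /h[rho rho0 hr].
exists rho => // k /hr; rewrite addrA -scalerDl.
by rewrite (_ : k *: (1 : R) = k) // /GRing.scale /= mulr1.
Qed.

Lemma is_derive_translate (V : normedModType R) (G : V -> R) (w p v : V) (d : R) :
  is_derive (w + p) v G d -> is_derive p v (fun y => G (w + y)) d.
Proof.
move=> /is_derive_elim h; apply: is_derive_intro => eta /h[rho rho0 hr].
by exists rho => // k /hr; rewrite addrCA.
Qed.

Lemma is_derive_scale_dir (V : normedModType R) (G : V -> R) p v (c d : R) :
  is_derive p v G d -> is_derive p (c *: v) G (c * d).
Proof.
move=> /is_derive_elim h; apply: is_derive_intro => eta eta0.
have c0 : 0 < `|c| + 1 by rewrite ltr_wpDl.
have [|rho rho0 hr] := h (eta / (`|c| + 1)); first by rewrite divr_gt0.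
exists (rho / (`|c| + 1)); first by rewrite divr_gt0.
move=> k; rewrite ltr_pdivlMr // => kr; rewrite scalerA mulrA.
apply: le_trans (hr _ _) _.
  rewrite normrM; apply: le_lt_trans kr; rewrite ler_wpM2l // lerDl //.
rewrite normrM (mulrC `|k|) mulrA ler_wpM2r // -mulrA ger_pMr //.
by rewrite ler_pdivrMl // mulr1 lerDl.
Qed.

Lemma norm_segment_lt (V : normedModType R) (u w : V) (rho th : R) :
  `|u| < rho -> `|w + u| < rho -> 0 <= th <= 1 -> `|th *: w + u| < rho.
Proof.
move=> h1 h2 /andP[t0 t1].
have -> : th *: w + u = (1 - th) *: u + th *: (w + u).
  by rewrite scalerBl scale1r scalerDr [X in _ = _ + X]addrC addrA subrK addrC.
apply: le_lt_trans (ler_normD _ _) _; rewrite !normrZ !ger0_norm ?subr_ge0 //.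
have mr : Num.max `|u| `|w + u| < rho by rewrite gt_max h1.
apply: le_lt_trans mr; set m := Num.max _ _.
have l1 : (1 - th) * `|u| <= (1 - th) * m by rewrite ler_wpM2l ?subr_ge0 // le_max lexx.
have l2 : th * `|w + u| <= th * m by rewrite ler_wpM2l // le_max lexx orbT.
by lra.
Qed.

(** The mean value theorem along one axis, against a reference slope [L]. It serves both
    differentiability from continuous partial derivatives and the symmetry of the Hessian. *)
Lemma partial_increment n (G : 'rV[R]_n -> R) (p : 'rV[R]_n) (rho eta L : R) i :
  (forall y, `|y - p| < rho -> derivable G y (evec R i)) ->
  (forall y, `|y - p| < rho -> `|'D_(evec R i) G y - L| <= eta) ->
  forall b c, `|b - p| < rho -> `|c *: evec R i + b - p| < rho ->
    `|G (c *: evec R i + b) - G b - c * L| <= eta * `|c|.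
Proof.
move=> hd hL b c b1 b2.
pose g (a : R) := G (a *: (c *: evec R i) + b).
have near_p (a : R) : 0 <= a <= 1 -> `|a *: (c *: evec R i) + b - p| < rho.
  by move=> a01; rewrite -addrA; apply: norm_segment_lt => //; rewrite addrA.
have dg (a : R) : 0 <= a <= 1 ->
    is_derive a 1 g (c * 'D_(evec R i) G (a *: (c *: evec R i) + b)).
  move=> /near_p h; apply: is_derive_path; apply: is_derive_scale_dir.
  exact/derivableP/hd.
have [||a] := @MVT_segment _ g (fun a : R => c * 'D_(evec R i) G (a *: (c *: evec R i) + b))
   0 1 ler01.
- by move=> a; rewrite in_itv /= => /andP[a0 a1]; apply: dg; rewrite !ltW.
- by apply: derivable_within_continuous => a; rewrite in_itv /= => /dg[].
rewrite in_itv /= => /near_p/hL h.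
rewrite /g scale1r scale0r add0r subr0 mulr1 => ->.
by rewrite -mulrBr normrM mulrC ler_wpM2r.
Qed.

(** The displacement is made one coordinate at a time; the bound on the sum of [|z_i|] keeps every
    corner of this path in the ball. *)
Lemma seq_increment n (G : 'rV[R]_n -> R) (p : 'rV[R]_n) (rho eta : R) (L : 'I_n -> R) (z : 'rV[R]_n)
    (s : seq 'I_n) :
  (forall i y, `|y - p| < rho -> derivable G y (evec R i)) ->
  (forall i y, `|y - p| < rho -> `|'D_(evec R i) G y - L i| <= eta) ->
  \sum_(i <- s) `|z 0 i| < rho ->
  `|G (\sum_(i <- s) z 0 i *: evec R i + p) - G p - \sum_(i <- s) z 0 i * L i|
    <= eta * \sum_(i <- s) `|z 0 i|.
Proof.
move=> hd hL.
have bnd (r : seq 'I_n) : `|\sum_(i <- r) z 0 i *: evec R i| <= \sum_(i <- r) `|z 0 i|.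
  apply: le_trans (ler_norm_sum _ _ _) _; apply: ler_sum => i _.
  by rewrite normrZ ler_piMr // norm_evec.
elim: s => [|i s IH]; first by rewrite !big_nil add0r subrr subrr normr0 mulr0.
move=> hs; have := bnd (i :: s); rewrite !big_cons in hs * => b1.
have hs' : \sum_(i <- s) `|z 0 i| < rho by apply: le_lt_trans hs; rewrite lerDr.
set b := \sum_(i <- s) z 0 i *: evec R i in b1 *.
have := @partial_increment _ G p rho eta (L i) i (hd i) (hL i) (b + p) (z 0 i).
rewrite addrK => /(_ (le_lt_trans (bnd s) hs')).
rewrite addrA addrK => /(_ (le_lt_trans b1 hs)) h1.
have := IH hs'; rewrite -/b mulrDr => h2.
apply: le_trans (lerD h1 h2); apply: le_trans _ (ler_normD _ _).
rewrite le_eqVlt; apply/orP; left; apply/eqP; congr `|_|; ring.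
Qed.

Lemma sum_coord_le n (z : 'rV[R]_n) : \sum_i `|z 0 i| <= n%:R * `|z|.
Proof.
apply: (le_trans (y := \sum_(i < n) `|z|)); first by apply: ler_sum => i _; exact: rV_coord_le.
by rewrite sumr_const card_ord mulr_natl.
Qed.

Lemma C1_directional n (G : 'rV[R]_n -> R) (U : set 'rV[R]_n) (p z : 'rV[R]_n) : open U -> U p ->
  (forall i y, U y -> derivable G y (evec R i)) ->
  (forall i, {for p, continuous (fun y => 'D_(evec R i) G y)}) ->
  is_derive p z G (\sum_i z 0 i * 'D_(evec R i) G p).
Proof.
move=> oU Up hd hc; apply: is_derive_intro => eta eta0.
have [r0 r00 hU] : exists2 r : R, 0 < r & forall y, `|y - p| < r -> U y.
  have /nbhs_ballP[r /= r0 hr] : nbhs p U by exact: open_nbhs_nbhs.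
  by exists r => // y yp; apply: hr; rewrite -ball_normE /= distrC.
(* [S] dominates the sum of the [|z_i|]; the added 1 makes it a legitimate divisor when [z = 0]. *)
pose S := n%:R * `|z| + 1.
have S0 : 0 < S by rewrite ltr_wpDl // mulr_ge0.
have eS : 0 < eta / S by rewrite divr_gt0.
have [r1 r10 h1] : exists2 r : R, 0 < r & forall i y, `|y - p| < r ->
    `|'D_(evec R i) G y - 'D_(evec R i) G p| <= eta / S.
  have : \forall y \near p, forall i, `|'D_(evec R i) G y - 'D_(evec R i) G p| <= eta / S.
    apply: (@filter_forall _ _
      (fun i y => `|'D_(evec R i) G y - 'D_(evec R i) G p| <= eta / S) (nbhs p)) => i.
    have /cvgrPdist_le/(_ _ eS) := hc i.
    by apply: filterS => y; rewrite distrC.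
  move=> /nbhs_ballP[r /= r0' hr]; exists r => // i y yp; apply: hr.
  by rewrite -ball_normE /= distrC.
pose rho := Num.min r0 r1.
have rho0 : 0 < rho by rewrite lt_min r00.
exists (rho / S); first by rewrite divr_gt0.
move=> h; rewrite ltr_pdivlMr // => hrho.
have sumE : \sum_i `|(h *: z) 0 i| <= `|h| * S.
  apply: le_trans (sum_coord_le _) _; rewrite normrZ mulrCA ler_wpM2l //.
  by rewrite lerDl.
have := @seq_increment n G p rho (eta / S) (fun i => 'D_(evec R i) G p) (h *: z) (index_enum _).
rewrite -rV_sum_evec => /(_ _ _ (le_lt_trans sumE hrho)) H.
have -> : h * (\sum_i z 0 i * 'D_(evec R i) G p) = \sum_i (h *: z) 0 i * 'D_(evec R i) G p.
  by rewrite mulr_sumr; apply: eq_bigr => i _; rewrite mxE mulrA.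
apply: le_trans (H _ _) _.
- by move=> i y yp; apply/hd/hU; apply: lt_le_trans yp _; rewrite ge_min lexx.
- by move=> i y yp; apply: h1; apply: lt_le_trans yp _; rewrite ge_min lexx orbT.
apply: le_trans (ler_wpM2l (ltW eS) sumE) _.
by rewrite (mulrC `|h|) mulrA divfK // gt_eqF.
Qed.

(** Two uses of the mean value theorem: on [g1], then on [g] minus the comparison quadratic. Only a
    bound on [g2] enters, not its continuity. *)
Lemma taylor2_ge (g g1 g2 : R -> R) (k : R) :
  (forall a : R, 0 <= a <= 1 -> is_derive a 1 g (g1 a)) ->
  (forall a : R, 0 <= a <= 1 -> is_derive a 1 g1 (g2 a)) ->
  (forall a : R, 0 <= a <= 1 -> k <= g2 a) ->
  g 0 + g1 0 + 2^-1 * k <= g 1.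
Proof.
move=> d1 d2 hk.
have le1 (a : R) : 0 <= a <= 1 -> g1 0 + k * a <= g1 a.
  move=> /andP[a0 a1].
  have [||c] := @MVT_segment _ g1 g2 0 a a0.
  - move=> c; rewrite in_itv /= => /andP[c0 c1]; apply: d2.
    by rewrite (ltW c0) (le_trans (ltW c1)).
  - apply: derivable_within_continuous => c; rewrite in_itv /= => /andP[c0 c1].
    by have [] := d2 c; rewrite // c0 (le_trans c1).
  rewrite in_itv /= subr0 => /andP[c0 c1] e.
  have := hk c; rewrite c0 (le_trans c1) // => /(_ isT) h.
  by have := ler_wpM2r a0 h; lra.
pose w (a : R) := g a - (g1 0 * a + 2^-1 * k * a ^+ 2).
have dw (a : R) : 0 <= a <= 1 -> is_derive a 1 w (g1 a - (g1 0 + k * a)).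
  move=> a01.
  have dq : is_derive a 1 (fun a : R => g1 0 * a + 2^-1 * k * a ^+ 2) (g1 0 + k * a).
    by apply: is_derive_eq; rewrite /GRing.scale /=; field.
  exact: (is_deriveB (d1 a a01) dq).
have [||c] := @MVT_segment _ w (fun a => g1 a - (g1 0 + k * a)) 0 1 ler01.
- by move=> c; rewrite in_itv /= => /andP[c0 c1]; apply: dw; rewrite !ltW.
- by apply: derivable_within_continuous => c; rewrite in_itv /= => /dw[].
rewrite in_itv /= => /le1 h; rewrite /w !mulr0 expr0n /= !mulr0 !mulr1 expr1n; lra.
Qed.

Lemma taylor2_le (g g1 g2 : R -> R) (k : R) :
  (forall a : R, 0 <= a <= 1 -> is_derive a 1 g (g1 a)) ->
  (forall a : R, 0 <= a <= 1 -> is_derive a 1 g1 (g2 a)) ->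
  (forall a : R, 0 <= a <= 1 -> g2 a <= k) ->
  g 1 <= g 0 + g1 0 + 2^-1 * k.
Proof.
move=> d1 d2 hk.
suff : - g 0 + - g1 0 + 2^-1 * - k <= - g 1 by lra.
apply: (@taylor2_ge (fun a => - g a) (fun a => - g1 a) (fun a => - g2 a)) => a ha.
- exact: (is_deriveN (d1 a ha)).
- exact: (is_deriveN (d2 a ha)).
- by rewrite lerN2 hk.
Qed.

End SecondOrderCalculus.

(** * Local expansion of test functions and properties of their Hessians *)

Section ParabolicTestFunctions.
Variables (R : realType) (n : nat) (Omega : set 'rV[R]_n) (t1 t2 : R).
Hypothesis oOmega : open Omega.
Implicit Types (phi g : 'rV[R]_n -> R -> R) (x y z : 'rV[R]_n).
Local Notation D := (cyl Omega t1 t2).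

Lemma cont_on_elim g x t : cont_on D g -> D (x, t) -> forall eta : R, 0 < eta ->
  exists2 rho : R, 0 < rho & forall y s, `|y - x| < rho -> `|s - t| < rho ->
    `|g y s - g x t| < eta.
Proof.
move=> gc /gc/cvgrPdist_lt h eta /h/nbhs_ballP[rho /= rho0 hr].
exists rho => // y s yx st; rewrite distrC; apply: (hr (y, s)).
by split; rewrite -ball_normE /= distrC.
Qed.

Lemma cont_on_slice g y s : cont_on D g -> D (y, s) ->
  {for y, continuous (fun y => g y s)}.
Proof.
move=> gc Dy; apply/(@cvgrPdist_lt _ _ _ (nbhs y)) => e e0.
have [rho rho0 hr] := cont_on_elim gc Dy e0.
apply/nbhs_ballP; exists rho => // y'; rewrite -ball_normE /= distrC => yy.
by rewrite distrC hr // subrr normr0.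
Qed.

Lemma cyl_nbhs x t : D (x, t) -> exists2 rho : R, 0 < rho &
  forall y s, `|y - x| < rho -> `|s - t| < rho -> D (y, s).
Proof.
move=> [/= Ox /andP[tl tr]].
have /nbhs_ballP[r /= r0 hr] : nbhs x Omega by exact: open_nbhs_nbhs.
exists (Num.min r (Num.min (t - t1) (t2 - t))).
  by rewrite !lt_min r0 !subr_gt0 tl tr.
move=> y s; rewrite !lt_min => /andP[yx _] /andP[_ /andP[s1 s2]]; split=> /=.
  by apply: hr; rewrite -ball_normE /= distrC.
move: s1 s2; rewrite !ltr_norml => /andP[s1 _] /andP[_ s2].
by apply/andP; split; lra.
Qed.

Definition gradx phi x t z : R := \sum_i z 0 i * dx i phi x t.

Lemma is_derive_dir phi y s z : C21 D phi -> D (y, s) ->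
  is_derive y z (fun y => phi y s) (gradx phi y s z).
Proof.
move=> [_ [h1 _]] Dy; have [Oy st] := Dy.
apply: (@C1_directional _ _ (fun y => phi y s) Omega) => //.
- by move=> i y' Oy'; have [+ _] := h1 i => /(_ (y', s)); apply.
- by move=> i; have [_ /cont_on_slice] := h1 i; apply.
Qed.

Lemma is_derive_grad phi y s z : C21 D phi -> D (y, s) ->
  is_derive y z (fun y => gradx phi y s z) (bform (hessian phi y s) z z).
Proof.
move=> [_ [_ [h2 _]]] Dy; have [Oy st] := Dy.
have dj j : is_derive y z (fun y => dx j phi y s) (gradx (dx j phi) y s z).
  apply: (@C1_directional _ _ (fun y => dx j phi y s) Omega) => //.
  - by move=> i y' Oy'; have [+ _] := h2 i j => /(_ (y', s)); apply.
  - by move=> i; have [_ /cont_on_slice] := h2 i j; apply.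
have := is_derive_sum (fun j => is_deriveZ (z 0 j) (dj j)).
rewrite (_ : \sum_(j < n) _ = fun y => gradx phi y s z); last first.
  by apply/funext => y'; rewrite fct_sumE.
move=> h; apply: (is_derive_eq h).
rewrite bformE exchange_big /=; apply: eq_bigr => j _.
rewrite /GRing.scale /= mulr_sumr; apply: eq_bigr => i _; rewrite mxE; ring.
Qed.

Lemma hessianE phi x t i j : hessian phi x t i j = dx i (dx j phi) x t.
Proof. by rewrite /hessian mxE. Qed.

Lemma hessian_dist phi x y t s i j :
  `|hessian phi y s i j - hessian phi x t i j| =
  `|dx i (dx j phi) y s - dx i (dx j phi) x t|.
Proof. by congr (`|_ - _|); exact: hessianE. Qed.

Lemma hessian_close phi x t : C21 D phi -> D (x, t) -> forall eta : R, 0 < eta ->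
  exists2 rho : R, 0 < rho & forall y s, `|y - x| < rho -> `|s - t| < rho ->
    D (y, s) /\ forall i j, `|hessian phi y s i j - hessian phi x t i j| <= eta.
Proof.
move=> [_ [_ [h2 _]]] Dx eta eta0.
have [r0 r00 hr0] := cyl_nbhs Dx.
have h (k : 'I_n * 'I_n) : exists r : R, 0 < r /\ forall y s, `|y - x| < r -> `|s - t| < r ->
    `|hessian phi y s k.1 k.2 - hessian phi x t k.1 k.2| <= eta.
  have [_ hc] := h2 k.1 k.2; have [r r0' hr] := cont_on_elim hc Dx eta0.
  exists r; split=> // y s yx st.
  by rewrite hessian_dist; apply/ltW/hr.
have [r hr] := choice h.
exists (\big[Num.min/r0]_k r k).
  by apply: lt_bigmin => // k _; have [] := hr k.
move=> y s yx st; split.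
  by apply: hr0; [apply: lt_le_trans yx _ | apply: lt_le_trans st _]; exact: bigmin_le_id.
move=> i j; have [_] := hr (i, j); apply.
  by apply: lt_le_trans yx _; exact: bigmin_le.
by apply: lt_le_trans st _; exact: bigmin_le.
Qed.

(** The value and gradient stay at time [s], because the linear term averages to zero at every time.
    Only the Hessian is frozen at [(x, t)]. The factor [n] comes from bounding a form by its
    entries. *)
Lemma taylor_x phi x t : C21 D phi -> D (x, t) -> forall eta : R, 0 < eta ->
  exists2 rho : R, 0 < rho & forall z s, `|z| < rho -> `|s - t| < rho ->
    phi x s + gradx phi x s z + 2^-1 * (bform (hessian phi x t) z z - eta * n%:R * sqn z)
      <= phi (x + z) s /\
    phi (x + z) s <=
      phi x s + gradx phi x s z + 2^-1 * (bform (hessian phi x t) z z + eta * n%:R * sqn z).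
Proof.
move=> Cphi Dx eta eta0; have [rho rho0 hr] := hessian_close Cphi Dx eta0.
exists rho => // z s zr st.
have near_x (a : R) : 0 <= a <= 1 -> `|a *: z + x - x| < rho.
  move=> /andP[a0 a1]; rewrite addrK normrZ; apply: le_lt_trans zr.
  by rewrite ler_piMl // ger0_norm.
have Da (a : R) : 0 <= a <= 1 -> D (a *: z + x, s) by move=> /near_x h; have [] := hr _ _ h st.
pose g (a : R) := phi (a *: z + x) s.
pose g1 (a : R) := gradx phi (a *: z + x) s z.
pose g2 (a : R) := bform (hessian phi (a *: z + x) s) z z.
have d1 (a : R) : 0 <= a <= 1 -> is_derive a 1 g (g1 a).
  move=> /Da Dax; apply: (@is_derive_path _ _ (fun y => phi y s)).
  exact: is_derive_dir.
have d2 (a : R) : 0 <= a <= 1 -> is_derive a 1 g1 (g2 a).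
  move=> /Da Dax; apply: (@is_derive_path _ _ (fun y => gradx phi y s z)).
  exact: is_derive_grad.
have bd (a : R) : 0 <= a <= 1 ->
    `|g2 a - bform (hessian phi x t) z z| <= eta * n%:R * sqn z.
  move=> /near_x h; have [_ hh] := hr _ _ h st.
  have -> : g2 a - bform (hessian phi x t) z z =
      bform (hessian phi (a *: z + x) s - hessian phi x t) z z.
    by rewrite bform_mxD bform_mxN.
  have subE (A B : 'M[R]_n) i j : (A - B) i j = A i j - B i j by rewrite !mxE.
  by apply: bform_entry_bound => i j; rewrite subE.
have E0 : g 0 = phi x s by rewrite /g scale0r add0r.
have E1 : g 1 = phi (x + z) s by rewrite /g scale1r addrC.
have E2 : g1 0 = gradx phi x s z by rewrite /g1 scale0r add0r.
rewrite -E0 -E1 -E2; split.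
  by apply: (taylor2_ge d1 d2) => a /bd; rewrite ler_distl => /andP[]; lra.
by apply: (taylor2_le d1 d2) => a /bd; rewrite ler_distl => /andP[]; lra.
Qed.

Lemma convex_above_tangent phi x z s : C21 D phi -> convex_in_x Omega t1 t2 phi ->
  t1 < s < t2 -> (forall a : R, 0 <= a <= 1 -> Omega (a *: z + x)) ->
  phi x s + gradx phi x s z <= phi (x + z) s.
Proof.
move=> Cphi cv st seg.
have Dx : D (x, s) by split=> //=; have := seg 0; rewrite scale0r add0r lexx ler01; apply.
have /is_derive_elim hd := is_derive_dir z Cphi Dx.
apply/ler_addgt0Pr => eta eta0; have [rho rho0 hr] := hd _ eta0.
pose h := Num.min 1 (rho / 2).
have h0 : 0 < h by rewrite lt_min ltr01 divr_gt0.
have h1 : h <= 1 by rewrite ge_min lexx.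
have hrho : `|h| < rho.
  rewrite gtr0_norm //; apply: (le_lt_trans (y := rho / 2)); last lra.
  by rewrite ge_min lexx orbT.
have := hr h hrho; rewrite (gtr0_norm h0) ler_distl => /andP[l _].
have := cv s x (x + z) h st.
have segE (m : R) : (1 - m) *: x + m *: (x + z) = m *: z + x.
  by rewrite scalerBl scale1r scalerDr addrA subrK addrC.
have segO (m : R) : 0 <= m <= 1 -> Omega ((1 - m) *: x + m *: (x + z)).
  by move=> /seg; rewrite segE.
move=> /(_ segO); rewrite segE (ltW h0) h1 => /(_ isT) c.
rewrite -(ler_pM2l h0); lra.
Qed.

(** Convexity puts [phi] above its tangent plane and Taylor puts it below the tangent plus a
    quadratic; at a small multiple of [v] the quadratic must be nonnegative up to [eta]. *)
Lemma hessian_psd_form phi x t v : C21 D phi -> convex_in_x Omega t1 t2 phi -> D (x, t) ->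
  0 <= bform (hessian phi x t) v v.
Proof.
move=> Cphi cv Dx; set H := hessian phi x t.
suff h (eta : R) : 0 < eta -> 0 <= bform H v v + eta * (n%:R * sqn v).
  rewrite leNgt; apply/negP => H0.
  have N0 : 0 <= n%:R * sqn v by rewrite mulr_ge0 // sqn_ge0.
  (* With this [eta] the correction offsets at most half of a negative value, a contradiction. *)
  have := h (- bform H v v / (2 * (n%:R * sqn v + 1))).
  have e0 : 0 < - bform H v v / (2 * (n%:R * sqn v + 1)).
    by rewrite divr_gt0 ?oppr_gt0 // mulr_gt0 // ltr_wpDl.
  move=> /(_ e0); rewrite leNgt => /negP; apply.
  set N := n%:R * sqn v in N0 e0 *.
  have : - bform H v v / (2 * (N + 1)) * N <= - bform H v v / 2.
    have N1 : 0 < N + 1 by rewrite ltr_wpDl.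
    have -> : - bform H v v / (2 * (N + 1)) * N = - bform H v v / 2 * (N / (N + 1)).
      by field; rewrite gt_eqF.
    rewrite ler_piMr // ?divr_ge0 // ?oppr_ge0 ?(ltW H0) //.
    by rewrite ler_pdivrMr // mul1r lerDl.
  lra.
move=> eta0; have [r0 r00 hr0] := cyl_nbhs Dx; have [r1 r10 hr1] := taylor_x Cphi Dx eta0.
pose h := Num.min r0 r1 / (2 * (`|v| + 1)).
have v0 : 0 < `|v| + 1 by rewrite ltr_wpDl.
have h0 : 0 < h by rewrite divr_gt0 ?lt_min ?r00 // mulr_gt0.
have hv : `|h *: v| < Num.min r0 r1.
  rewrite normrZ gtr0_norm // /h mulrAC ltr_pdivrMr ?mulr_gt0 //.
  by rewrite ltr_pM2l ?lt_min ?r00 //; have := normr_ge0 v; lra.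
have [hv0 hv1] : `|h *: v| < r0 /\ `|h *: v| < r1.
  by move: hv; rewrite lt_min => /andP[].
have tt : `|t - t| = 0 by rewrite subrr normr0.
have tt1 : `|t - t| < r1 by rewrite tt.
have [_] := hr1 (h *: v) t hv1 tt1.
have := @convex_above_tangent phi x (h *: v) t Cphi cv Dx.2.
have seg (a : R) : 0 <= a <= 1 -> Omega (a *: (h *: v) + x).
  move=> /andP[a0 a1]; have [] := hr0 (a *: (h *: v) + x) t; rewrite ?tt //=.
  rewrite addrK normrZ; apply: le_lt_trans hv0.
  by rewrite ler_piMl // ger0_norm.
move=> /(_ seg) l1 l2; have := le_trans l1 l2.
rewrite lerDl pmulr_rge0 ?invr_gt0 //.
have -> : sqn (h *: v) = h ^+ 2 * sqn v.
  by rewrite !sqnE linearZ /= -scalemxAr -scalemxAl scalerA mxE expr2.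
rewrite bformZl bformZr => l.
rewrite -(pmulr_rge0 _ (exprn_gt0 2 h0)); move: l; congr (0 <= _); ring.
Qed.

(* [De k l], a second difference of [phi], is symmetric in [k] and [l] and is
   compared with either mixed derivative by two mean value estimates. *)
Lemma hessian_sym phi x t : C21 D phi -> D (x, t) -> (hessian phi x t)^T = hessian phi x t.
Proof.
move=> Cphi Dx; have [_ [h1 [h2 _]]] := Cphi.
apply/matrixP => i j; rewrite [LHS]mxE.
apply/eqP; rewrite -subr_eq0 -normr_le0; apply/ler_addgt0Pr => e e0; rewrite add0r.
have eta0 : 0 < e / 2 by rewrite divr_gt0.
have [rho rho0 hr] := hessian_close Cphi Dx eta0.
have tt : `|t - t| < rho by rewrite subrr normr0.
(* Points within [2 * h] of [x], shifted by a further [h], stay in the ball of radius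
   [rho = 3 * h]. *)
pose h := rho / 3.
have h0 : 0 < h by rewrite divr_gt0.
have eve (k : 'I_n) (a : R) : 0 <= a -> `|a *: evec R k| <= a.
  by move=> a0; rewrite normrZ ger0_norm // ler_piMr // norm_evec.
pose De k l := phi (h *: evec R l + (h *: evec R k + x)) t - phi (h *: evec R k + x) t
             - (phi (h *: evec R l + x) t - phi x t).
have key (k l : 'I_n) : `|De k l - h * (h * dx l (dx k phi) x t)| <= e / 2 * h * h.
  pose G y := phi (h *: evec R l + y) t - phi y t.
  have sh y : `|y - x| < 2 * h -> `|y - x| < rho /\ `|h *: evec R l + y - x| < rho.
    have e3 : rho = 3 * h by rewrite /h; field.
    move=> yx; split; first lra.
    rewrite -addrA; apply: le_lt_trans (ler_normD _ _) _.
    by have := eve l h (ltW h0); lra.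
  have dG y : `|y - x| < 2 * h ->
      is_derive y (evec R k) G (dx k phi (h *: evec R l + y) t - dx k phi y t).
    move=> /sh[y1 y2]; have [D1 _] := hr _ _ y1 tt; have [D2 _] := hr _ _ y2 tt.
    have [h1k _] := h1 k.
    apply: (@is_deriveB _ _ _ (fun y => phi (h *: evec R l + y) t) (fun y => phi y t)).
      apply: (@is_derive_translate _ _ (fun y => phi y t)).
      exact: (derivableP (h1k _ D2)).
    exact: (derivableP (h1k _ D1)).
  have cl y : `|y - x| < 2 * h ->
      `|'D_(evec R k) G y - h * dx l (dx k phi) x t| <= e / 2 * h.
    move=> yx; have [_ ->] := dG y yx; have [y1 y2] := sh y yx.
    have := @partial_increment _ _ (fun y => dx k phi y t) x rho (e / 2)
      (dx l (dx k phi) x t) l.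
    rewrite -[in X in _ -> _ <= X](gtr0_norm h0); apply => //.
    - by move=> y' /hr/(_ tt)[Dy' _]; have [+ _] := h2 l k => /(_ _ Dy').
    - move=> y' /hr/(_ tt)[_ /(_ l k)].
      by rewrite hessian_dist.
  have := @partial_increment _ _ G x (2 * h) (e / 2 * h) (h * dx l (dx k phi) x t) k
    _ cl x h.
  rewrite (gtr0_norm h0) subrr normr0 addrK mulr_gt0 // => /(_ _ isT); apply.
  - by move=> y /dG[].
  - by apply: le_lt_trans (eve k h (ltW h0)) _; lra.
have DeC : De i j = De j i.
  rewrite /De addrCA; move: (phi _ t) (phi _ t) (phi _ t) (phi _ t) => a b c d; ring.
have fin (X Y S : R) : `|S - h * (h * X)| <= e / 2 * h * h ->
    `|S - h * (h * Y)| <= e / 2 * h * h -> `|X - Y| <= e.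
  rewrite !ler_distl => /andP[a1 a2] /andP[b1 b2].
  have hh : 0 < h * h by rewrite mulr_gt0.
  by apply/andP; split; rewrite -(ler_pM2r hh); lra.
rewrite (hessianE phi x t j i) (hessianE phi x t i j).
have := key j i; rewrite -DeC => k2.
exact: fin (key i j) k2.
Qed.

Lemma hessian_psd phi x t : test_fun Omega t1 t2 phi -> D (x, t) -> psdmx (hessian phi x t).
Proof.
move=> [Cphi cv] Dx; split; first exact: hessian_sym.
by move=> v; apply: hessian_psd_form.
Qed.

Lemma taylor_t phi x t : C21 D phi -> D (x, t) -> forall eta : R, 0 < eta ->
  exists2 rho : R, 0 < rho & forall s, `|s - t| < rho ->
    `|phi x s - phi x t - (s - t) * dt phi x t| <= eta * `|s - t|.
Proof.
move=> [_ [_ [_ [h _]]]] /h/derivableP/is_derive_elim hd eta /hd[rho rho0 hr].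
exists rho => // s /hr; rewrite /GRing.scale /= mulr1 subrK; exact.
Qed.

End ParabolicTestFunctions.

(** * Expansion of the space-time averages and of their infimum *)

Section MeanValueExpansion.
Variable R : realType.
Local Notation mu := (@lebesgue_measure R).

Lemma near_at_right0 (P : R -> Prop) : (\forall e \near 0^'+, P e) ->
  exists2 e0 : R, 0 < e0 & forall e, 0 < e < e0 -> P e.
Proof.
move=> [e0 /= e00 h]; exists e0 => // e /andP[ep el].
by apply: h => //=; rewrite sub0r normrN gtr0_norm.
Qed.

Lemma at_right0_near (P : R -> Prop) (e0 : R) : 0 < e0 ->
  (forall e, 0 < e < e0 -> P e) -> \forall e \near 0^'+, P e.
Proof.
move=> e00 h; exists e0 => //= e; rewrite /= sub0r normrN => el ep.
by apply: h; rewrite ep -(gtr0_norm ep).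
Qed.

(** The hypothesis says that [g e / e ^+ 2] tends to [k], so the quotient of the positive part tends
    to the maximum of [k] and 0. *)
Lemma cvg_positive_part (g : R -> R) (k : R) :
  (forall dl : R, 0 < dl -> exists2 e0 : R, 0 < e0 & forall e, 0 < e < e0 ->
     `|g e - k * e ^+ 2| <= dl * e ^+ 2) ->
  (Num.max (g e) 0 / e ^+ 2 @[e --> 0^'+] --> (0 : R)) <-> k <= 0.
Proof.
move=> hg; split=> [/cvgrPdist_lt h|k0].
  rewrite leNgt; apply/negP => k0; have k2 : 0 < k / 2 by rewrite divr_gt0.
  have [e1 e10 h1] := near_at_right0 (h _ k2); have [e2 e20 h2] := hg _ k2.
  pose e := Num.min e1 e2 / 2.
  have m0 : 0 < Num.min e1 e2 by rewrite lt_min e10.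
  have ep : 0 < e by rewrite divr_gt0.
  have em : e < Num.min e1 e2 by rewrite /e; lra.
  have := h1 e; have := h2 e; move: em; rewrite lt_min ep => /andP[-> ->] /(_ isT) l1 /(_ isT).
  have ee : 0 < e ^+ 2 by rewrite exprn_gt0.
  rewrite sub0r normrN; apply/negP; rewrite -leNgt; apply: le_trans (ler_norm _).
  rewrite ler_pdivlMr // le_max; apply/orP; left.
  by move: l1; rewrite ler_distl => /andP[]; lra.
apply/cvgrPdist_le => dl dl0; have [e0 e00 h] := hg _ dl0.
apply: (at_right0_near e00) => e ee; have /andP[ep _] := ee.
have e2 : 0 < e ^+ 2 by rewrite exprn_gt0.
rewrite sub0r normrN ger0_norm; last by rewrite divr_ge0 ?(ltW e2) // le_max lexx orbT.
rewrite ler_pdivrMr // ge_max mulr_ge0 ?(ltW dl0) ?(ltW e2) // andbT.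
have := h e ee; rewrite ler_distl => /andP[_ l].
by have := mulr_le0_ge0 k0 (ltW e2); lra.
Qed.

Lemma integrable_affine (t tau a b : R) :
  mu.-integrable `[t - tau, t]%classic (EFin \o (fun s => a + b * (s - t))).
Proof.
apply: continuous_compact_integrable; first exact: segment_compact.
apply: continuous_subspaceT => s; apply: cvgD; first exact: cvg_cst.
by apply: cvgM; [exact: cvg_cst | apply: cvgB; [exact: cvg_id | exact: cvg_cst]].
Qed.

Lemma time_average_affine (t tau a b : R) : 0 < tau ->
  tau^-1 * \int[mu]_(s in `[t - tau, t]%classic) (a + b * (s - t)) = a - b * tau / 2.
Proof.
move=> tau0; pose F (s : R) := a * s + 2^-1 * b * (s - t) ^+ 2.
have -> : \int[mu]_(s in `[t - tau, t]%classic) (a + b * (s - t)) = F t - F (t - tau).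
  have cs : continuous (fun s : R => s - t).
    by move=> s; apply: cvgB; [exact: cvg_id | exact: cvg_cst].
  apply: Rintegral_FTC2.
  - by rewrite gtrBl.
  - move=> s; apply: cvgD; first exact: cvg_cst.
    by apply: cvgM; [exact: cvg_cst | exact: cs].
  - move=> s; apply: cvgD; first by apply: cvgM; [exact: cvg_cst | exact: cvg_id].
    apply: cvgM; first exact: cvg_cst.
    exact: (cvgM (cs s) (cs s)).
  - by move=> s _; apply: is_derive_eq; rewrite /GRing.scale /=; field.
by rewrite /F; field; rewrite gt_eqF.
Qed.

(* [P], [D] and [E] stand for [phi x t], [dt phi x t] and [eps ^+ 2]. *)
Lemma lower_error (c dl th d E P D : R) : 0 < c <= 2^-1 -> 0 < dl -> 0 <= E -> th * d <= dl ->
  P + c * (d - D) * E - dl * E <=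
  P - dl / 2 * (2 * c * E) + c * ((1 - th) * d) * E - D * (2 * c * E) / 2.
Proof.
move=> /andP[c0 c1] dl0 E0 thd; rewrite -subr_ge0.
rewrite (_ : _ - _ = E * (dl - c * dl - c * (th * d))); last by field.
rewrite mulr_ge0 //.
have k1 : c * dl <= 2^-1 * dl by rewrite ler_pM2r.
have k2 : c * (th * d) <= c * dl by rewrite ler_pM2l.
lra.
Qed.

(** [N] stands for the dimension. The time error costs at most [dl / 2 * E] and the trace error at
    most [dl / 4 * E]. *)
Lemma upper_error (c N dl d E P D : R) : 0 < c <= 2^-1 -> 0 < N -> 0 < dl -> 0 <= E ->
  c = N / (2 * (N + 2)) ->
  P + dl / 2 * (2 * c * E) + E / (2 * (N + 2)) * (N * d + dl / 2) - D * (2 * c * E) / 2 <=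
  P + c * (d - D) * E + dl * E.
Proof.
move=> /andP[c0 c1] N0 dl0 E0 cE; rewrite -subr_ge0.
have N2 : 0 < N + 2 by rewrite addr_gt0.
rewrite (_ : _ - _ = E * (dl - c * dl - (N + 2)^-1 * (dl / 4))); last first.
  by rewrite cE; field; rewrite gt_eqF.
rewrite mulr_ge0 //.
have k1 : c * dl <= 2^-1 * dl by rewrite ler_pM2r.
have k2 : (N + 2)^-1 * (dl / 4) <= dl / 4.
  by rewrite ger_pMl ?divr_gt0 // invf_le1 //; lra.
lra.
Qed.

Section Averages.
Variables (n : nat) (Omega : set 'rV[R]_n) (t1 t2 : R) (phi : 'rV[R]_n -> R -> R).
Variables (x : 'rV[R]_n) (t : R).
Hypotheses (n0 : (0 < n)%N) (oOmega : open Omega) (tphi : test_fun Omega t1 t2 phi).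
Hypothesis Dx : cyl Omega t1 t2 (x, t).

Definition space_avg (A : 'M[R]_n) (eps s : R) : R :=
  ball_avg eps (fun y => phi (x + y *m A) s).

Definition space_time_avg (A : 'M[R]_n) (eps tau : R) : R :=
  tau^-1 * \int[mu]_(s in `[t - tau, t]%classic) space_avg A eps s.

Lemma test_fun_bound : exists M rho : R, [/\ 0 <= M, 0 < rho &
  forall z s, `|z| < rho -> `|s - t| < rho ->
    cyl Omega t1 t2 (x + z, s) /\ `|phi (x + z) s| <= M].
Proof.
have [[pc _] _] := tphi.
have [r1 r10 h1] := cyl_nbhs oOmega Dx; have [r2 r20 h2] := cont_on_elim pc Dx ltr01.
exists (`|phi x t| + 1), (Num.min r1 r2); split=> //; first by rewrite lt_min r10.
move=> z s; rewrite !lt_min => /andP[z1 z2] /andP[s1 s2].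
have zE : `|x + z - x| = `|z| by rewrite addrC addKr.
split; first by apply: h1; rewrite ?zE.
have := h2 (x + z) s; rewrite zE => /(_ z2 s2) h.
rewrite -[phi (x + z) s](subrK (phi x t)) addrC.
by apply: le_trans (ler_normD _ _) _; rewrite lerD2l ltW.
Qed.

Section FixedMatrix.
Variables (A : 'M[R]_n) (eps M rho : R).
Hypotheses (M0 : 0 <= M) (eps0 : 0 < eps).
Hypothesis hrho : forall z s, `|z| < rho -> `|s - t| < rho ->
    cyl Omega t1 t2 (x + z, s) /\ `|phi (x + z) s| <= M.
Hypothesis hA : forall y : 'rV[R]_n, sqn y < eps ^+ 2 -> `|y *m A| < rho.

Lemma cbounded_section (s : R) : `|s - t| < rho ->
  cbounded (eps ^+ 2) M (fun y : 'rV[R]_n => phi (x + y *m A) s).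
Proof.
move=> st; have [[pc _] _] := tphi; split=> y /hA yr; last by have [] := hrho yr st.
have [Dy _] := hrho yr st.
have gc := cont_on_slice pc Dy.
have hc : {for y, continuous (fun y : 'rV[R]_n => x + y *m A)}.
  apply: (@cvg_rV _ _ (nbhs y)) => i.
  rewrite !mxE; under eq_fun do rewrite !mxE.
  have [_ _ [c _]] : cbd (sqn y + 1) (fun y : 'rV[R]_n => x 0 i + \sum_j y 0 j * A j i).
    apply: cbdD; first exact: cbd_cst.
    by apply: cbd_sum => j; apply: cbdM; [exact: cbd_coord | exact: cbd_cst].
  by apply: c; rewrite ltrDl.
exact: (@continuous_comp _ _ _ (fun y : 'rV[R]_n => x + y *m A) (fun y => phi y s) y hc gc).
Qed.

Lemma space_avg_continuous (s : R) : `|s - t| < rho ->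
  {for s, continuous (space_avg A eps)}.
Proof.
move=> st; have [[pc _] _] := tphi.
apply/continuous_withinNx; apply/cvgr_dnbhsP => u [_ us].
(* The convergence lemma wants its bounds for every index, so the finitely many terms outside the
   neighbourhood are replaced by [s]. *)
pose u' k := if `|u k - t| < rho then u k else s.
have u't k : `|u' k - t| < rho by rewrite /u'; case: ifP.
have near_u : \forall k \near \oo, `|u k - t| < rho.
  have r0 : 0 < rho - `|s - t| by rewrite subr_gt0.
  have /cvgrPdist_lt/(_ _ r0) := us; apply: filterS => k; rewrite distrC => h.
  have -> : u k - t = (u k - s) + (s - t) by rewrite addrA subrK.
  by apply: le_lt_trans (ler_normD _ _) _; rewrite -ltrBrDr.
have eu : \forall k \near \oo, u k = u' k.
  by apply: filterS near_u => k h; rewrite /u' h.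
have u's : u' k @[k --> \oo] --> s.
  by apply: cvg_trans us; exact: near_eq_cvg.
suff h : space_avg A eps (u' k) @[k --> \oo] --> space_avg A eps s.
  apply: cvg_trans h; apply: near_eq_cvg; apply: filterS eu => k e.
  by rewrite /= -e.
rewrite /space_avg ball_avgE //; under eq_fun do rewrite ball_avgE //.
apply: cvgM; last exact: cvg_cst.
have [_ hc] := ballint_bound_cvg R n.
apply: (hc _ _ M eps) => //.
- exact: ltW.
- by rewrite exprn_gt0.
- exact: cvg_cst.
- by move=> k; apply: cbounded_section.
- exact: cbounded_section.
move=> y /hA yr; have [Dy _] := hrho yr st.
apply/cvgrPdist_lt => e e0; have [r r0 hr] := cont_on_elim pc Dy e0.
have /cvgrPdist_lt/(_ _ r0) := u's; apply: filterS => k; rewrite distrC => h.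
by rewrite distrC; apply: hr; rewrite ?subrr ?normr0.
Qed.

Lemma space_avg_integrable (tau : R) : 0 < tau < rho ->
  mu.-integrable `[t - tau, t]%classic (EFin \o space_avg A eps).
Proof.
move=> /andP[tau0 tr].
apply: continuous_compact_integrable; first exact: segment_compact.
apply: continuous_in_subspaceT => s; rewrite inE /= in_itv /= => /andP[s1 s2].
by apply: space_avg_continuous; rewrite ler0_norm ?subr_le0 //; lra.
Qed.

Lemma space_time_avg_ge (tau a b : R) : 0 < tau < rho ->
  (forall s, t - tau <= s <= t -> a + b * (s - t) <= space_avg A eps s) ->
  a - b * tau / 2 <= space_time_avg A eps tau.
Proof.
move=> tr h; have /andP[tau0 _] := tr.
rewrite -(time_average_affine t a b tau0) /space_time_avg ler_pM2l ?invr_gt0 //.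
apply: le_Rintegral => //; first exact: integrable_affine.
exact: space_avg_integrable.
Qed.

Lemma space_time_avg_le (tau a b : R) : 0 < tau < rho ->
  (forall s, t - tau <= s <= t -> space_avg A eps s <= a + b * (s - t)) ->
  space_time_avg A eps tau <= a - b * tau / 2.
Proof.
move=> tr h; have /andP[tau0 _] := tr.
rewrite -(time_average_affine t a b tau0) /space_time_avg ler_pM2l ?invr_gt0 //.
apply: le_Rintegral => //; first exact: space_avg_integrable.
exact: integrable_affine.
Qed.

Section OneSided.
Variables (K : 'M[R]_n) (s : R).
Hypothesis st : `|s - t| < rho.

(** The quadratic model in the variable of the ball: pulling back by [A] gives the shape handled by
    [ballint_quadratic]. *)
Let model (y : 'rV[R]_n) : R :=
  phi x s + \sum_i (\sum_j A i j * dx j phi x s) * y 0 i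
  + 2^-1 * bform (A *m K *m A^T) y y.

Let modelE y : model y = phi x s + gradx phi x s (y *m A) + 2^-1 * bform K (y *m A) (y *m A).
Proof.
rewrite /model bform_congr; congr (_ + _ + _); rewrite /gradx.
under eq_bigr do rewrite mulr_suml.
rewrite exchange_big /=; apply: eq_bigr => j _; rewrite mxE mulr_suml.
by apply: eq_bigr => i _; ring.
Qed.

Let cbd_model : cbd (eps ^+ 2) model.
Proof.
apply: cbdD; last first.
  apply: cbdM; first exact: cbd_cst.
  under eq_fun do rewrite bformE.
  apply: cbd_sum => i; apply: cbd_sum => j; apply: cbdM; last exact: cbd_coord.
  by apply: cbdM; [exact: cbd_coord | exact: cbd_cst].
apply: cbdD; first exact: cbd_cst.
by apply: cbd_sum => i; apply: cbdM; [exact: cbd_cst | exact: cbd_coord].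
Qed.

Let model_avg : ballint (eps ^+ 2) model / ballint (eps ^+ 2) (fun _ : 'rV[R]_n => 1) =
  phi x s + eps ^+ 2 / (2 * n.+2%:R) * \tr (A *m K *m A^T).
Proof.
rewrite ballint_quadratic mulfK // gt_eqF // ball_volume_gt0 // exprn_gt0 //.
Qed.

Lemma space_avg_ge :
  (forall z, `|z| < rho -> phi x s + gradx phi x s z + 2^-1 * bform K z z <= phi (x + z) s) ->
  phi x s + eps ^+ 2 / (2 * n.+2%:R) * \tr (A *m K *m A^T) <= space_avg A eps s.
Proof.
move=> h; rewrite -model_avg /space_avg ball_avgE // ler_pM2r; last first.
  by rewrite invr_gt0 ball_volume_gt0 // exprn_gt0.
apply: le_ballint => //; first by exists M => //; exact: cbounded_section.
by move=> y /hA /h; rewrite modelE.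
Qed.

Lemma space_avg_le :
  (forall z, `|z| < rho -> phi (x + z) s <= phi x s + gradx phi x s z + 2^-1 * bform K z z) ->
  space_avg A eps s <= phi x s + eps ^+ 2 / (2 * n.+2%:R) * \tr (A *m K *m A^T).
Proof.
move=> h; rewrite -model_avg /space_avg ball_avgE // ler_pM2r; last first.
  by rewrite invr_gt0 ball_volume_gt0 // exprn_gt0.
apply: le_ballint => //; first by exists M => //; exact: cbounded_section.
by move=> y /hA /h; rewrite modelE.
Qed.

End OneSided.
End FixedMatrix.

Local Notation H := (hessian phi x t).
Local Notation d := ((\det H) `^ n%:R^-1).

(* If [H] is degenerate the bound [0] is obtained from convexity alone: the
   second order Taylor error is not controlled uniformly over the matrices [A]. *)
Lemma lower_model (th : R) : 0 < th < 1 -> exists K, exists2 rho : R, 0 < rho &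
  (forall A, spd A -> \det A = 1 -> (1 - th) * (n%:R * d) <= \tr (A *m K *m A^T)) /\
  forall z s, `|z| < rho -> `|s - t| < rho ->
    phi x s + gradx phi x s z + 2^-1 * bform K z z <= phi (x + z) s.
Proof.
move=> /andP[th0 th1]; have [Cphi cv] := tphi.
have Hp := hessian_psd oOmega tphi Dx.
have nR : (0 : R) < n%:R by rewrite ltr0n.
have [dH|dH] := eqVneq (\det H) 0.
  have [rho rho0 hr] := cyl_nbhs oOmega Dx.
  exists 0, rho => //; split.
    move=> A _ _; rewrite dH powR0 ?invr_eq0 ?gt_eqF //.
    by rewrite mulmx0 mul0mx mxtrace0 !mulr0.
  move=> z s zr st; rewrite /bform mulmx0 mul0mx [X in _ * X]mxE mulr0 addr0.
  have seg (a : R) : 0 <= a <= 1 -> cyl Omega t1 t2 (a *: z + x, s).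
    move=> /andP[a0 a1]; apply: hr => //; rewrite addrK normrZ.
    by apply: le_lt_trans zr; rewrite ler_piMl // ger0_norm.
  apply: (convex_above_tangent oOmega Cphi cv); last by move=> a /seg[].
  by have [] := seg 0; rewrite ?lexx ?ler01.
have Hs := psd_unit_spd Hp dH.
have [l l0 hl] := spd_coercive Hs.
(* With this [eta] the Taylor error is [th * l * sqn z], which coercivity bounds by [th] times the
   form of [H]. *)
have eta0 : 0 < th * l / n%:R by rewrite divr_gt0 // mulr_gt0.
have [rho rho0 hr] := taylor_x oOmega Cphi Dx eta0.
exists ((1 - th) *: H), rho => //; split.
  move=> A As dA; rewrite -scalemxAr -scalemxAl linearZ /=.
  by rewrite ler_wpM2l ?subr_ge0 ?(ltW th1) // trace_congr_ge.
move=> z s zr st; have [+ _] := hr z s zr st; apply: le_trans.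
rewrite lerD2l ler_pM2l ?invr_gt0 // bform_mxZ divfK ?gt_eqF //.
by have := ler_wpM2l (ltW th0) (hl z); lra.
Qed.

(** Degenerate [H] needs no separate case: [A] is chosen first, and [eta] is then taken small
    relative to the trace of [A *m A^T]. *)
Lemma upper_model (dl : R) : 0 < dl -> exists A K, exists2 rho : R, 0 < rho &
  [/\ spd A, \det A = 1, \tr (A *m K *m A^T) <= n%:R * d + dl &
  forall z s, `|z| < rho -> `|s - t| < rho ->
    phi (x + z) s <= phi x s + gradx phi x s z + 2^-1 * bform K z z].
Proof.
move=> dl0; have [Cphi cv] := tphi.
have dl2 : 0 < dl / 2 by rewrite divr_gt0.
have nR : (0 : R) < n%:R by rewrite ltr0n.
have [A [As dA hA]] := near_optimal_congr n0 (hessian_psd oOmega tphi Dx) dl2.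
pose T : R := `|\tr (A *m A^T)|; have T0 : 0 < T + 1 by rewrite /T ltr_wpDl.
pose eta := dl / (2 * (n%:R * (T + 1))).
have eta0 : 0 < eta by rewrite divr_gt0 // !mulr_gt0.
have [rho rho0 hr] := taylor_x oOmega Cphi Dx eta0.
exists A, (H + (eta * n%:R)%:M), rho => //; split=> //.
  rewrite mulmxDr mulmxDl linearD /= mul_mx_scalar -scalemxAl linearZ /=.
  have : eta * n%:R * \tr (A *m A^T) <= dl / 2.
    apply: (le_trans (y := eta * n%:R * (T + 1))).
      have e0 : 0 <= eta * n%:R by rewrite mulr_ge0 // ltW.
      have le : \tr (A *m A^T) <= T by exact: ler_norm.
      by apply: (ler_wpM2l e0); lra.
    rewrite (_ : eta * n%:R * (T + 1) = dl / 2) // /eta; field.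
    by rewrite !gt_eqF.
  lra.
move=> z s zr st; have [_] := hr z s zr st.
by rewrite bform_mxD bform_scalar.
Qed.

Variable psi : R -> R.
Hypothesis psi_gt0 : forall e, 0 < e -> 0 < psi e.
Hypothesis psi_pinfty : psi e @[e --> 0^'+] --> +oo.
Hypothesis psi_small : e * psi e @[e --> 0^'+] --> (0 : R).

Lemma mulmx_norm_lt (A : 'M[R]_n) (th eps : R) (y : 'rV[R]_n) :
  spd A -> mx_le_scalar A th -> 0 < th -> 0 < eps -> sqn y < eps ^+ 2 ->
  `|y *m A| < eps * th.
Proof.
move=> As Ath th0 e0 ye.
rewrite -ltr_sqr ?nnegrE ?mulr_ge0 ?(ltW th0) ?(ltW e0) //.
apply: le_lt_trans (sqr_norm_le_sqn _) _; apply: le_lt_trans (sqn_mulmx_le _ As Ath) _.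
by rewrite exprMn mulrC ltr_pM2r // exprn_gt0.
Qed.

(** The first inequality confines the images [y A] of the ball, the second the time window. *)
Lemma small_scale (rho : R) : 0 < rho -> exists2 e0 : R, 0 < e0 & forall e, 0 < e < e0 ->
  e * psi e < rho /\ e ^+ 2 < rho.
Proof.
move=> rho0; move/cvgrPdist_lt: psi_small => /(_ _ rho0)/near_at_right0[e1 e10 h1].
exists (Num.min e1 (Num.min 1 rho)); first by rewrite !lt_min e10 ltr01.
move=> e /andP[ep]; rewrite !lt_min => /andP[ee1 /andP[e_1 er]].
have := h1 e; rewrite ep ee1 sub0r normrN => /(_ isT) h; split.
  by apply: le_lt_trans h; exact: ler_norm.
by apply: lt_trans er; rewrite expr2 gtr_pMr.
Qed.

(** [c * eps ^+ 2] is both half the time window, hence the weight of [- dt phi], and [n] times the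
    factor [eps ^+ 2 / (2 * (n + 2))] of the trace, hence the weight of [d]. The window length makes
    the two agree. *)
Let c : R := n%:R / (2 * (n%:R + 2)).
Let tau (eps : R) : R := n%:R / (n%:R + 2) * eps ^+ 2.

Let nR : (0 : R) < n%:R. Proof. by rewrite ltr0n. Qed.
Let c_gt0 : 0 < c.
Proof. by rewrite /c divr_gt0 // mulr_gt0 // addr_gt0. Qed.
Let c_le : c <= 2^-1.
Proof. by rewrite /c ler_pdivrMr ?mulr_gt0 ?addr_gt0 //; lra. Qed.
Let tauE eps : tau eps = 2 * c * eps ^+ 2.
Proof. by rewrite /tau /c; field; rewrite gt_eqF // addr_gt0. Qed.
Let n2E : n.+2%:R = n%:R + 2 :> R. Proof. by rewrite -addn2 natrD. Qed.

Let tau_lt (eps rho : R) : 0 < eps -> eps ^+ 2 < rho -> 0 < tau eps < rho.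
Proof.
move=> e0 er; have e2 : 0 < eps ^+ 2 by rewrite exprn_gt0.
rewrite tauE mulr_gt0 //=; last by rewrite mulr_gt0.
by apply: le_lt_trans er; rewrite ger_pMl //; have := c_le; lra.
Qed.

Let time_dist (eps rho s : R) : 0 < eps -> eps ^+ 2 < rho -> t - tau eps <= s <= t ->
  `|s - t| < rho /\ `|s - t| <= tau eps.
Proof.
move=> e0 er /andP[s1 s2]; have /andP[_ tr] := tau_lt e0 er.
have le : `|s - t| <= tau eps by rewrite ler0_norm ?subr_le0 //; lra.
by split=> //; apply: le_lt_trans tr.
Qed.

Lemma avg_ge (dl : R) : 0 < dl -> exists2 e0 : R, 0 < e0 & forall eps, 0 < eps < e0 ->
  forall A, spd A -> \det A = 1 -> mx_le_scalar A (psi eps) ->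
  phi x t + c * (d - dt phi x t) * eps ^+ 2 - dl * eps ^+ 2 <=
    space_time_avg A eps (tau eps).
Proof.
move=> dl0; have [Cphi cv] := tphi.
have d0 : 0 <= d := powR_ge0 _ _.
(* The first bound keeps [th < 1]; the second gives [th * d <= dl], the loss allowed in the trace
   term. *)
pose th := Num.min (2^-1) (dl / (d + 1)).
have d1 : 0 < d + 1 by rewrite ltr_wpDl.
have th0 : 0 < th by rewrite lt_min invr_gt0 ltr0n divr_gt0.
have th1 : th < 1.
  by apply: (@le_lt_trans _ _ (2^-1)); [rewrite ge_min lexx | lra].
have thd : th * d <= dl.
  apply: (@le_trans _ _ (dl / (d + 1) * d)).
    by rewrite ler_wpM2r // ge_min lexx orbT.
  by rewrite mulrAC ler_pdivrMr // ler_pM2l // lerDl.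
have [K [r1 r10 [hK h1]]] := lower_model (introT andP (conj th0 th1)).
have [M [r2 [M0 r20 h2]]] := test_fun_bound.
have dl2 : 0 < dl / 2 by rewrite divr_gt0.
have [r3 r30 h3] := taylor_t Cphi Dx dl2.
pose rho := Num.min r1 (Num.min r2 r3).
have rho0 : 0 < rho by rewrite !lt_min r10 r20.
have lt_rho a : a < rho -> [/\ a < r1, a < r2 & a < r3].
  by rewrite !lt_min => /andP[-> /andP[-> ->]].
have [e0 e00 he] := small_scale rho0.
exists e0 => // eps ee A As dA Ale; have /andP[ep _] := ee.
have [ep1 ep2] := he eps ee.
have hA (y : 'rV[R]_n) : sqn y < eps ^+ 2 -> `|y *m A| < rho.
  by move=> ye; apply: lt_trans ep1; apply: mulmx_norm_lt => //; exact: psi_gt0.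
have hM z s : `|z| < rho -> `|s - t| < rho ->
    cyl Omega t1 t2 (x + z, s) /\ `|phi (x + z) s| <= M.
  by move=> /lt_rho[_ z2 _] /lt_rho[_ s2 _]; exact: h2.
(* In the window the time error is at most [dl / 2 * tau eps], so [a + dt phi x t * (s - t)] is an
   affine minorant of the space averages. *)
pose a := phi x t - dl / 2 * tau eps + c * ((1 - th) * d) * eps ^+ 2.
have e2 : 0 < eps ^+ 2 by rewrite exprn_gt0.
apply: (@le_trans _ _ (a - dt phi x t * tau eps / 2)).
  by rewrite /a tauE; apply: lower_error; rewrite ?c_gt0 ?c_le // ltW.
apply: (space_time_avg_ge M0 ep hM hA (tau_lt ep ep2)) => s sI.
have [sr st] := time_dist ep ep2 sI.
have [s1 _ s3] := lt_rho _ sr.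
have hz z : `|z| < rho -> phi x s + gradx phi x s z + 2^-1 * bform K z z <= phi (x + z) s.
  by move=> /lt_rho[z1 _ _]; exact: h1.
apply: le_trans (space_avg_ge M0 ep hM hA sr hz).
have := h3 s s3; rewrite ler_distl => /andP[l _].
have l2 : dl / 2 * `|s - t| <= dl / 2 * tau eps by rewrite ler_pM2l.
have l3 : c * ((1 - th) * d) * eps ^+ 2 <=
    eps ^+ 2 / (2 * n.+2%:R) * \tr (A *m K *m A^T).
  have -> : c * ((1 - th) * d) * eps ^+ 2 =
      eps ^+ 2 / (2 * n.+2%:R) * ((1 - th) * (n%:R * d)).
    by rewrite n2E /c; field; rewrite gt_eqF // addr_gt0.
  rewrite ler_pM2l; first exact: hK.
  by rewrite divr_gt0 // mulr_gt0 // ltr0n.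
have fin (P Q D w X Y Z W : R) : w * D - X <= Q - P -> X <= Y -> Z <= W ->
    P - Y + Z + D * w <= Q + W by rewrite (mulrC D); lra.
exact: fin l l2 l3.
Qed.

Lemma avg_le (dl : R) : 0 < dl -> exists2 e0 : R, 0 < e0 & forall eps, 0 < eps < e0 ->
  exists A, [/\ spd A, \det A = 1, mx_le_scalar A (psi eps) &
  space_time_avg A eps (tau eps) <=
    phi x t + c * (d - dt phi x t) * eps ^+ 2 + dl * eps ^+ 2].
Proof.
move=> dl0; have [Cphi cv] := tphi.
have dl2 : 0 < dl / 2 by rewrite divr_gt0.
have [A [K [r1 r10 [As dA hK h1]]]] := upper_model dl2.
have [M [r2 [M0 r20 h2]]] := test_fun_bound.
have [r3 r30 h3] := taylor_t Cphi Dx dl2.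
pose rho := Num.min r1 (Num.min r2 r3).
have rho0 : 0 < rho by rewrite !lt_min r10 r20.
have lt_rho a : a < rho -> [/\ a < r1, a < r2 & a < r3].
  by rewrite !lt_min => /andP[-> /andP[-> ->]].
have [e0 e00 he] := small_scale rho0.
have [C hC] := spd_le_scalar As.
(* [A] was fixed before [eps], so divergence of [psi] makes it admissible for all small [eps]. *)
have [e1 e10 h4] : exists2 e1 : R, 0 < e1 & forall e, 0 < e < e1 -> C <= psi e.
  by apply: near_at_right0; move/cvgryPge: psi_pinfty; exact.
exists (Num.min e0 e1); first by rewrite lt_min e00.
move=> eps /andP[ep]; rewrite lt_min => /andP[ee0 ee1].
have Ale : mx_le_scalar A (psi eps) by apply: hC; apply: h4; rewrite ep.
have [|ep1 ep2] := he eps; first by rewrite ep.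
exists A; split=> //.
have hA (y : 'rV[R]_n) : sqn y < eps ^+ 2 -> `|y *m A| < rho.
  by move=> ye; apply: lt_trans ep1; apply: mulmx_norm_lt => //; exact: psi_gt0.
have hM z s : `|z| < rho -> `|s - t| < rho ->
    cyl Omega t1 t2 (x + z, s) /\ `|phi (x + z) s| <= M.
  by move=> /lt_rho[_ z2 _] /lt_rho[_ s2 _]; exact: h2.
pose a := phi x t + dl / 2 * tau eps + eps ^+ 2 / (2 * (n%:R + 2)) * (n%:R * d + dl / 2).
have e2 : 0 < eps ^+ 2 by rewrite exprn_gt0.
apply: (@le_trans _ _ (a - dt phi x t * tau eps / 2)); last first.
  by rewrite /a tauE; apply: upper_error; rewrite ?c_gt0 ?c_le // ltW.
apply: (space_time_avg_le M0 ep hM hA (tau_lt ep ep2)) => s sI.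
have [sr st] := time_dist ep ep2 sI.
have [s1 _ s3] := lt_rho _ sr.
have hz z : `|z| < rho -> phi (x + z) s <= phi x s + gradx phi x s z + 2^-1 * bform K z z.
  by move=> /lt_rho[z1 _ _]; exact: h1.
apply: le_trans (space_avg_le M0 ep hM hA sr hz) _.
have := h3 s s3; rewrite ler_distl => /andP[_ l].
have l2 : dl / 2 * `|s - t| <= dl / 2 * tau eps by rewrite ler_pM2l.
have l3 : eps ^+ 2 / (2 * n.+2%:R) * \tr (A *m K *m A^T) <=
    eps ^+ 2 / (2 * (n%:R + 2)) * (n%:R * d + dl / 2).
  by rewrite n2E ler_pM2l // divr_gt0 // mulr_gt0 // addr_gt0.
have fin (P Q D w X Y Z W : R) : Q - P <= w * D + X -> X <= Y -> Z <= W ->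
    Q + Z <= P + Y + W + D * w by rewrite (mulrC D); lra.
exact: fin l l2 l3.
Qed.

Lemma M_eps_expansion (f : 'rV[R]_n -> R -> R) (dl : R) : 0 < dl ->
  exists2 e0 : R, 0 < e0 & forall eps, 0 < eps < e0 ->
  `|- phi x t + M_eps psi f eps phi x t - c * (d - dt phi x t + f x t) * eps ^+ 2|
    <= dl * eps ^+ 2.
Proof.
move=> dl0; have [e1 e10 h1] := avg_ge dl0; have [e2 e20 h2] := avg_le dl0.
exists (Num.min e1 e2); first by rewrite lt_min e10.
move=> eps /andP[ep]; rewrite lt_min => /andP[ee1 ee2].
have {}h1 := h1 eps (introT andP (conj ep ee1)).
have [A [As dA Ale hA]] := h2 eps (introT andP (conj ep ee2)).
rewrite /M_eps; set E := [set a | _]; rewrite -/(tau eps) -/c in E *.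
set lo := phi x t + c * (d - dt phi x t) * eps ^+ 2 - dl * eps ^+ 2 in h1.
(* [inf] has its usual meaning only on nonempty sets bounded below: [avg_ge] gives the minorant, and
   the matrix from [avg_le] gives an element. *)
have loE : lbound E lo.
  by move=> _ [B [Bs dB Ble ->]]; exact: h1.
have EA : E (space_time_avg A eps (tau eps)) by exists A.
have l1 : lo <= inf E by apply: lb_le_inf => //; exists (space_time_avg A eps (tau eps)).
have l2 : inf E <= space_time_avg A eps (tau eps) by apply: ge_inf => //; exists lo.
have {hA l2}l2 := le_trans l2 hA.
rewrite ler_distl; move: l1 l2; rewrite /lo; move: (inf E) (dt phi x t) => I D l1 l2.
by apply/andP; split; lra.
Qed.

End Averages.
End MeanValueExpansion.

(** * Equivalence of the two viscosity notions *)

Unset Implicit Arguments. Set Strict Implicit.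

Theorem theorem2p1 (R : realType) (n : nat) (Omega : set 'rV[R]_n) (t1 t2 : R)
    (f u : 'rV[R]_n -> R -> R) (psi : R -> R) :
  (0 < n)%N ->
  open Omega -> t1 < t2 ->
  cont_on (cyl Omega t1 t2) f ->
  (forall e, 0 < e -> 0 < psi e) ->
  psi e @[e --> 0^'+] --> +oo ->
  e * psi e @[e --> 0^'+] --> (0 : R) ->
  cont_on (cyl Omega t1 t2) u ->
  convex_in_x Omega t1 t2 u ->
  (visc_sol Omega t1 t2 f u <-> amvp_visc Omega t1 t2 psi f u).
Proof.
move=> n0 oO t12 _ psi0 psioo psi1 _ _.
have c0 : 0 < n%:R / (2 * (n%:R + 2)) :> R.
  by rewrite divr_gt0 ?ltr0n // mulr_gt0 // ltr_wpDl.
(* Each one-sided asymptotic relation for [phi] is equivalent to one differential inequality at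
   [(x, t)]; the contact conditions on [u] are common to both definitions. *)
have key x t phi : Omega x -> t1 < t < t2 -> test_fun Omega t1 t2 phi ->
    ((fun e => Num.max (- phi x t + M_eps psi f e phi x t) 0 / e ^+ 2) @ 0^'+ --> (0 : R) <->
     f x t <= dt phi x t - (\det (hessian phi x t)) `^ n%:R^-1) /\
    ((fun e => Num.max (- (- phi x t + M_eps psi f e phi x t)) 0 / e ^+ 2) @ 0^'+ --> (0 : R) <->
     dt phi x t - (\det (hessian phi x t)) `^ n%:R^-1 <= f x t).
  move=> Ox tt tphi.
  have ex := M_eps_expansion n0 oO tphi (conj Ox tt) psi0 psioo psi1 f.
  have h1 := cvg_positive_part ex.
  have h2 := @cvg_positive_part _ (fun e => - (- phi x t + M_eps psi f e phi x t))
    (- (n%:R / (2 * (n%:R + 2)) *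
       ((\det (hessian phi x t)) `^ n%:R^-1 - dt phi x t + f x t))).
  split.
    apply: iff_trans h1 _; rewrite pmulr_rle0 //.
    by move: (dt phi x t) => D; split; lra.
  apply: iff_trans (h2 _) _.
    move=> dl /ex[e0 e00 he]; exists e0 => // e /he.
    by rewrite mulNr -opprD normrN.
  rewrite oppr_le0 pmulr_rge0 //.
  by move: (dt phi x t) => D; split; lra.
(* One definition lists the maximum clause first and the other the minimum clause, hence the crossed
   indices. *)
split=> h x t phi Ox tt tphi; have [k1 k2] := key x t phi Ox tt tphi;
  have [h1 h2] := h x t phi Ox tt tphi; split=> s e.
- exact/k1/h2.
- exact/k2/h1.
- exact/k2/h2.
- exact/k1/h1.
Qed.
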